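(* Let $\Gamma\subset\mathbb R^2$ be open, let $R_{\max}>0$, and let $\mathbf u_1,\mathbf u_2\in H_e^1$. Set $\Omega_{\Gamma,R_{\max}}:=\bigcup_{\mathbf x'\in\Gamma}B(\mathbf x',R_{\max})$. Then $$\mathcal M\mathbf u_1=\mathcal M\mathbf u_2\ \text{ a.e. on }\Gamma\times(0,R_{\max})\quad\Longleftrightarrow\quad\nabla\!\cdot(\mathbf u_1-\mathbf u_2)=0\ \text{ a.e. on }\Omega_{\Gamma,R_{\max}}.$$
   Context: Write $\mathbf x=(\mathbf x',x_3)\in\mathbb R^3$ with $\mathbf x'=(x_1,x_2)$. $B(\mathbf x',r)$ is the open ball in $\mathbb R^3$ with center $(\mathbf x',0)$ and radius $r$. Symmetry class: $\sigma(\mathbf x',x_3)=(\mathbf x',-x_3)$, $J=\operatorname{diag}(1,1,-1)$, and $H_e^1=\{\mathbf u\in H^1(\mathbb R^3;\mathbb R^3):\mathbf u(\sigma\mathbf x)=J\mathbf u(\mathbf x)\text{ for a.e. }\mathbf x\}$, with $H^1$ the usual $L^2$-based Sobolev space of real vector fields. Forward operator: for $\mathbf u\in H_e^1$, $$(\mathcal M\mathbf u)(\mathbf x',r)=-\frac1{r^4}\int_{B(\mathbf x',r)}\nabla\!\cdot\mathbf u(\mathbf y)\,d\mathbf y,\qquad(\mathbf x',r)\in\mathbb R^2\times(0,\infty).$$ *)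

(* Defs.v *)
From HB Require Import structures.
From mathcomp Require Import all_boot all_order all_algebra.
From mathcomp Require Import all_classical all_reals all_analysis.

Set Implicit Arguments.
Unset Strict Implicit.
Unset Printing Implicit Defensive.

Import Order.TTheory GRing.Theory Num.Theory.
Import numFieldNormedType.Exports.

Local Open Scope classical_set_scope.
Local Open Scope ring_scope.

(* A point (x', x_3) of R^3, and likewise a pair (x', r) of a center and a
   radius, is an element of (R * R) * R. *)

Notation leb3 R :=
  ((@lebesgue_measure R \x @lebesgue_measure R) \x @lebesgue_measure R)%E.

Definition comp3 (R : realType) (i : 'I_3) (x : R * R * R) : R :=
  match val i with 0%N => x.1.1 | 1%N => x.1.2 | _ => x.2 end.

Definition basis3 (R : realType) (i : 'I_3) : R * R * R :=
  ((val i == 0%N)%:R, (val i == 1%N)%:R, (val i == 2%N)%:R).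

(* The norm that the library puts on a product type, and hence its [ball], is
   the sup norm; it is used below only for topology and differentiation. *)
Definition enorm (R : realType) (x : R * R * R) : R :=
  Num.sqrt (\sum_(i < 3) comp3 i x ^+ 2).

Definition eball (R : realType) (x' : R * R) (r : R) : set (R * R * R) :=
  [set y | enorm (y - (x', 0)) < r].

(* Both the reflection sigma and the matrix J = diag(1, 1, -1). *)
Definition reflection (R : realType) (x : R * R * R) : R * R * R :=
  (x.1, - x.2).

Definition in_L2 (R : realType) (f : R * R * R -> R) : Prop :=
  f \in Lfun (leb3 R) 2%:E.

Fixpoint is_Ck (R : realType) (k : nat) (phi : R * R * R -> R) : Prop :=
  continuous phi /\
  if k is k'.+1 then
    forall i : 'I_3, (forall x, derivable phi x (basis3 R i)) /\
                     is_Ck k' (fun x => 'D_(basis3 R i) phi x)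
  else True.

(* C_c^oo(R^3) *)
Definition test_function (R : realType) (phi : R * R * R -> R) : Prop :=
  (forall k, is_Ck k phi) /\ compact (closure [set x | phi x != 0]).

Definition is_weak_partial (R : realType) (i : 'I_3) (f g : R * R * R -> R) :
    Prop :=
  in_L2 g /\
  forall phi : R * R * R -> R, test_function phi ->
    \int[leb3 R]_x (f x * 'D_(basis3 R i) phi x) =
    - \int[leb3 R]_x (g x * phi x).

Definition sobolev_H1 (R : realType) (u : R * R * R -> R * R * R) : Prop :=
  forall i : 'I_3, in_L2 (comp3 i \o u) /\
    forall j : 'I_3, exists g, is_weak_partial j (comp3 i \o u) g.

Definition sobolev_H1e (R : realType) (u : R * R * R -> R * R * R) : Prop :=
  sobolev_H1 u /\ {ae leb3 R, forall x, u (reflection x) = reflection (u x)}.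

(* A representative, chosen arbitrarily, of the almost everywhere unique weak
   derivative; junk value 0 if there is none in L^2. *)
Definition weak_partial (R : realType) (i : 'I_3) (f : R * R * R -> R) :
    R * R * R -> R :=
  xget (fun=> 0) [set g | is_weak_partial i f g].

Definition divergence (R : realType) (u : R * R * R -> R * R * R)
    (x : R * R * R) : R :=
  \sum_(i < 3) weak_partial i (comp3 i \o u) x.

Definition forwardM (R : realType) (u : R * R * R -> R * R * R)
    (p : R * R * R) : R :=
  - (p.2 ^+ 4)^-1 * \int[leb3 R]_(y in eball p.1 p.2) divergence u y.

Definition Omega (R : realType) (Gamma : set (R * R)) (Rmax : R) :
    set (R * R * R) :=
  \bigcup_(x' in Gamma) eball x' Rmax.

(* Main.v *)
Require Import Defs.
From mathcomp Require Import all_boot all_order all_algebra.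
From mathcomp Require Import all_classical all_reals all_analysis.
From mathcomp Require Import measurable_realfun.
From mathcomp Require Import ring lra.
Import numFieldNormedType.Exports.
Import Order.TTheory GRing.Theory Num.Theory.

Set Implicit Arguments.
Unset Strict Implicit.
Unset Printing Implicit Defensive.

Local Open Scope classical_set_scope.
Local Open Scope ring_scope.

(** Let f be the difference of the two divergences.  It is locally integrable,
and it is even in the third coordinate because reflecting a field of the
symmetry class reflects its weak derivatives.  The two transforms agree at
(x, r) exactly when f integrates to zero over the ball of radius r about
(x, 0), so one direction is immediate and the other is a uniqueness theorem: an
even function whose integrals over the balls centred on Gamma, with squared
radius below T, all vanish is zero almost everywhere on the union of these
balls.

The idea is the one of Courant and Hilbert: differentiate in the centre.  Write
rho x y for the squared distance of y to (x, 0).  Averaging the balls about x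
over their squared radius shows that f integrates to zero against the cone
max 0 (t - rho x y) ([ball_null_cone]).  In the direction v, the derivative of
this cone in x is 2 (v . (y' - x)) times the indicator of the ball, where y' is
the pair of the first two coordinates of y.  Hence y |-> f(y) (v . y') again
integrates to zero over every ball ([ball_null_lin]), and so does f times any
polynomial in y'.  The polynomials (1 - s ^ n) ^ (2 ^ n), with s affine in y',
converge to the indicator of the half-space s < 1/2, so f also integrates to
zero over the intersections of a ball with y1 < a and y2 < b
([ball_null_quadrant]).

For a fixed centre x these intersections form a pi-system in the coordinates
(y1, y2, rho x y).  By Dynkin's theorem f integrates to zero over every
measurable set described by these coordinates, within the ball.  An even
function is a function of these coordinates, so the sets f > 0 and f < 0 are
among them and f vanishes almost everywhere in the ball ([ae_eq0_dynkin],
[ball_null_ae_eq0]).  Countably many rational centres and radii cover Omega.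

The transforms are only assumed to agree almost everywhere, but the integral
over a ball depends continuously on the ball, since spheres are null, so the
hypothesis propagates to all balls ([ball_null_of_ae]).

The divergence is built from arbitrarily chosen weak derivatives.  Products of
the functions exp (-1/x), suitably placed, are test functions that converge to
the indicators of open boxes; hence test functions separate locally integrable
functions ([ae_eq_window3]).  This makes weak derivatives unique almost
everywhere, which gives linearity ([divergenceB]) and evenness
([divergence_reflection]) of the divergence. *)

(** * Three-dimensional space and its Lebesgue measure *)

(** The Borel sets of the reals come with two measurable structures that have the
same sets but different displays.  Lebesgue measure lives on the generated one,
so measurability is stated on the corresponding product. *)
Notation space R := (measurableTypeR R * measurableTypeR R * measurableTypeR R)%type.

Definition vol (R : realType) : {measure set (space R) -> \bar R} :=
  [the {measure set (space R) -> \bar R} of leb3 R].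

#[local] Instance vol_ae_filter (R : realType) : Filter (nbhs (almost_everywhere (vol R))).
Proof. exact: (@ae_filter_ringOfSetsType _ (space R) R (vol R)). Qed.

Lemma measurable_coords (R : realType) :
  [/\ measurable_fun [set: space R] (fun y : space R => y.1.1),
      measurable_fun [set: space R] (fun y : space R => y.1.2) &
      measurable_fun [set: space R] (fun y : space R => y.2)].
Proof.
split; last exact: measurable_snd.
  exact: (measurableT_comp measurable_fst measurable_fst).
exact: (measurableT_comp measurable_snd measurable_fst).
Qed.

Lemma measurable_lt_set d (T : measurableType d) (R : realType) (f : T -> R)
    (c : R) : measurable_fun setT f -> measurable [set y | f y < c].
Proof.
move=> mf; have -> : [set y | f y < c] = setT `&` f @^-1` `]-oo, c[%classic.
  by apply/seteqP; split => y /=; rewrite ?in_itv //= => -[].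
by apply: mf => //; exact: measurable_itv.
Qed.

(** * Orthants generate the Borel sets *)

Definition orthant (R : realType) (a b c : R) : set (R * R * R) :=
  [set y | [/\ y.1.1 < a, y.1.2 < b & y.2 < c]].

(** A pi-system generating the Borel sets, adapted to the coordinates
(y1, y2, rho) in which integrals over rho < c are known. *)
Definition orthants (R : realType) : set (set (R * R * R)) :=
  [set A | exists a b c, A = orthant a b c].

Lemma setI_closed_orthants (R : realType) : setI_closed (@orthants R).
Proof.
move=> _ _ [a [b [c ->]]] [a' [b' [c' ->]]].
exists (Num.min a a'), (Num.min b b'), (Num.min c c').
apply/seteqP; split => y /=; rewrite /orthant /=.
  by move=> [[h1 h2 h3] [h4 h5 h6]]; rewrite !lt_min h1 h2 h3 h4 h5 h6.
by rewrite !lt_min => -[/andP[-> ->] /andP[-> ->] /andP[-> ->]].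
Qed.

(** A half-space y_i < c is an increasing union of orthants; this is the form in
which that union is used. *)
Lemma orthants_bigcup (R : realType) (P : set (R * R * R)) (a b c : nat -> R) :
  (forall y, P y <-> exists n, orthant (a n) (b n) (c n) y) ->
  <<s @orthants R >> P.
Proof.
move=> h.
have -> : P = \bigcup_n orthant (a n) (b n) (c n).
  apply/seteqP; split => y /=; first by move/h => [n hn]; exists n.
  by move=> [n _ hn]; apply/h; exists n.
have [_ _ + ] := @smallest_sigma_algebra _ [set: R * R * R] (@orthants R).
apply=> n.
by apply: sub_sigma_algebra; exists (a n), (b n), (c n).
Qed.

Lemma ex_nat_gt2 (R : realType) (x y : R) : exists n : nat, x < n%:R /\ y < n%:R.
Proof.
exists (Num.truncn (Num.max x y)).+1.
by have := Num.Theory.truncnS_gt (Num.max x y); rewrite gt_max => /andP[].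
Qed.

(** The identity map from the sigma-algebra generated by the orthants to the
product sigma-algebra is measurable because each of its coordinates is. *)
Lemma measurable_sub_orthants (R : realType) (A : set (space R)) :
  measurable A -> <<s @orthants R >> A.
Proof.
move=> mA.
pose S := g_sigma_algebraType (@orthants R).
have mS (B : set S) : <<s @orthants R >> B = measurable B by [].
have m0 : measurable_fun [set: S] (fun y : S => (y : R * R * R).1.1).
  apply: (measurability _ (RGenInftyO.measurableE R)) => _ [_ [x ->]] <-.
  rewrite setTI -mS.
  apply: (@orthants_bigcup R _ (fun=> x) (fun n => n%:R) (fun n => n%:R)) => y.
  rewrite /= in_itv /=; split; last by move=> [n []].
  by move=> h; have [n [h1 h2]] := ex_nat_gt2 y.1.2 y.2; exists n.
have m1 : measurable_fun [set: S] (fun y : S => (y : R * R * R).1.2).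
  apply: (measurability _ (RGenInftyO.measurableE R)) => _ [_ [x ->]] <-.
  rewrite setTI -mS.
  apply: (@orthants_bigcup R _ (fun n => n%:R) (fun=> x) (fun n => n%:R)) => y.
  rewrite /= in_itv /=; split; last by move=> [n []].
  by move=> h; have [n [h1 h2]] := ex_nat_gt2 y.1.1 y.2; exists n.
have m2 : measurable_fun [set: S] (fun y : S => (y : R * R * R).2).
  apply: (measurability _ (RGenInftyO.measurableE R)) => _ [_ [x ->]] <-.
  rewrite setTI -mS.
  apply: (@orthants_bigcup R _ (fun n => n%:R) (fun n => n%:R) (fun=> x)) => y.
  rewrite /= in_itv /=; split; last by move=> [n []].
  by move=> h; have [n [h1 h2]] := ex_nat_gt2 y.1.1 y.1.2; exists n.
have mid := measurable_fun_pair (measurable_fun_pair m0 m1) m2.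
have := mid measurableT _ mA; rewrite setTI.
by congr measurable; apply/seteqP; split => -[[]].
Qed.

(** * Locally integrable functions and their pairings *)

(** Boxes exhaust space and have finite measure; they serve to localize
integrability and to bound supports. *)
Definition box (R : realType) (M : R) : set (R * R * R) :=
  [set y | [/\ `|y.1.1| <= M, `|y.1.2| <= M & `|y.2| <= M]].

Lemma boxE (R : realType) (M : R) :
  box M = (`[- M, M]%classic `*` `[- M, M]%classic) `*` `[- M, M]%classic.
Proof.
apply/seteqP; split => y; rewrite /box /= !in_itv /= -!ler_norml.
  by move=> [-> -> ->].
by move=> [[]].
Qed.

Lemma measurable_box (R : realType) (M : R) : measurable (box M : set (space R)).
Proof.
rewrite boxE; apply: measurableX; last exact: measurable_itv.
by apply: measurableX; exact: measurable_itv.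
Qed.

Lemma box_le (R : realType) (M M' : R) : M <= M' -> box M `<=` box M'.
Proof.
by move=> MM y [h0 h1 h2]; split; [move: h0|move: h1|move: h2] => /le_trans; apply.
Qed.

Lemma le_of_eq d (T : porderType d) (x y : T) : x = y -> (x <= y)%O.
Proof. by move=> ->. Qed.

Lemma box_finite (R : realType) (M : R) : (vol R (box M) < +oo)%E.
Proof.
have fin1 : @lebesgue_measure R `[- M, M]%classic \is a fin_num.
  by rewrite lebesgue_measure_itv /=; case: ifP => _; rewrite ?fin_numB.
have mI : measurable (`[- M, M]%classic : set R) by exact: measurable_itv.
have h2 := product_measure1E (@lebesgue_measure R) (@lebesgue_measure R) mI mI.
have h3 := product_measure1E (@lebesgue_measure R \x @lebesgue_measure R)%E
  (@lebesgue_measure R) (measurableX mI mI) mI.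
rewrite boxE; apply: (le_lt_trans (le_of_eq h3)).
rewrite ltey_eq fin_numM //.
by have := h2 => /= ->; rewrite fin_numM.
Qed.

(** Together with [locbd] and [bsupp] this sets up a pairing: the integral of
h * w is used only for h locally integrable and w locally bounded with bounded
support, where it is always absolutely convergent. *)
Definition locint (R : realType) (h : R * R * R -> R) : Prop :=
  measurable_fun [set: space R] h /\
  forall M : R, (vol R).-integrable (box M) (EFin \o h).

Lemma locint_integrableM (R : realType) (h w : R * R * R -> R) (C M : R) :
  locint h -> measurable_fun [set: space R] w ->
  (forall y, box M y -> `|w y| <= C) -> (forall y, ~ box M y -> w y = 0) ->
  (vol R).-integrable setT (EFin \o (fun y => h y * w y)).
Proof.
move=> [mh ih] mw wC w0.
have : (vol R).-integrable (box M) (EFin \o (fun y => h y * w y)).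
  have := @integrableMl _ _ _ (vol R) (box M) (measurable_box M) (EFin \o h) w
    (ih M) (measurable_funS measurableT (@subsetT _ _) mw).
  apply; exists C; split; first exact: num_real.
  by move=> x Cx y /wC /le_trans; apply; exact: ltW.
have H := @integrable_mkcond _ _ _ (vol R) (box M)
  (EFin \o (fun y => h y * w y)) (measurable_box M).
move=> /H; apply: eq_integrable => // y _.
rewrite /= patchE; case: ifPn => //.
by rewrite notin_setE => /w0 ->; rewrite mulr0.
Qed.

Lemma locintM (R : realType) (h w : R * R * R -> R) :
  locint h -> measurable_fun [set: space R] w ->
  (forall M, exists C, forall y, box M y -> `|w y| <= C) ->
  locint (fun y => h y * w y).
Proof.
move=> [mh ih] mw wC; split; first exact: measurable_funM.
move=> M; have [C hC] := wC M.
have := @integrableMl _ _ _ (vol R) (box M) (measurable_box M) (EFin \o h) w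
    (ih M) (measurable_funS measurableT (@subsetT _ _) mw).
apply; exists C; split; first exact: num_real.
by move=> x Cx y /hC /le_trans; apply; exact: ltW.
Qed.

(** Because |f| <= 1 + f ^ 2 and boxes have finite measure. *)
Lemma locint_L2 (R : realType) (f : R * R * R -> R) : in_L2 f -> locint f.
Proof.
move=> f2; have mf : measurable_fun [set: space R] f.
  by move: f2; rewrite /in_L2 inE => /andP[+ _]; rewrite inE.
split=> // M.
have i2 : (vol R).-integrable (box M) (EFin \o (fun y => 1 + f y ^+ 2)).
  have -> : EFin \o (fun y => 1 + f y ^+ 2) =
      (cst 1%:E \+ (EFin \o (fun y => f y ^+ 2)%R))%E by [].
  apply: integrableD; first exact: measurable_box.
    apply: (@measurable_bounded_integrable _ _ _ (vol R) (cst 1)).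
    - exact: measurable_box.
    - exact: box_finite.
    - exact: measurable_cst.
    - by exists 1; split; [exact: num_real|move=> x /ltW x1 y _; rewrite /= normr1 //].
  apply: (integrableS measurableT) => //; first exact: measurable_box.
  exact: Lfun2_integrable_sqr.
apply: le_integrable i2; first exact: measurable_box.
  by apply/measurable_EFinP; exact: measurable_funS mf.
move=> y _ /=; rewrite lee_fin [leRHS]ger0_norm; last by rewrite addr_ge0 // sqr_ge0.
by rewrite -[f y ^+ 2]real_normK ?num_real //; nra.
Qed.

Definition locbd (R : realType) (w : R * R * R -> R) : Prop :=
  measurable_fun [set: space R] w /\
  forall M, exists C, forall y, box M y -> `|w y| <= C.

Lemma locbd_cst (R : realType) (c : R) : locbd (fun=> c).
Proof. by split; [exact: measurable_cst|move=> M; exists `|c|]. Qed.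

Lemma locbd_coord (R : realType) : [/\ locbd (fun y : R * R * R => y.1.1),
  locbd (fun y : R * R * R => y.1.2) & locbd (fun y : R * R * R => y.2)].
Proof.
have [m0 m1 m2] := measurable_coords R.
by split; (split; [by []|move=> M; exists M => y []]).
Qed.

Lemma locbdD (R : realType) (v w : R * R * R -> R) :
  locbd v -> locbd w -> locbd (fun y => v y + w y).
Proof.
move=> [mv bv] [mw bw]; split; first exact: measurable_funD.
move=> M; have [C hC] := bv M; have [C' hC'] := bw M; exists (C + C') => y yM.
by rewrite (le_trans (ler_normD _ _)) // lerD ?hC ?hC'.
Qed.

Lemma locbdM (R : realType) (v w : R * R * R -> R) :
  locbd v -> locbd w -> locbd (fun y => v y * w y).
Proof.
move=> [mv bv] [mw bw]; split; first exact: measurable_funM.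
move=> M; have [C hC] := bv M; have [C' hC'] := bw M; exists (C * C') => y yM.
by rewrite normrM ler_pM ?hC ?hC'.
Qed.

Lemma locbdN (R : realType) (w : R * R * R -> R) :
  locbd w -> locbd (fun y => - w y).
Proof.
move=> [mw bw]; split; first exact: measurableT_comp.
by move=> M; have [C hC] := bw M; exists C => y; rewrite normrN => /hC.
Qed.

Lemma locbdX (R : realType) (w : R * R * R -> R) n :
  locbd w -> locbd (fun y => w y ^+ n).
Proof.
move=> lw; elim: n => [|n IH].
  by under eq_fun do rewrite expr0; exact: locbd_cst.
by under eq_fun do rewrite exprS; exact: locbdM.
Qed.

Lemma locbd_indic (R : realType) (A : set (space R)) :
  measurable A -> locbd (\1_A : R * R * R -> R).
Proof.
move=> mA; split; first exact: measurable_indic.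
by move=> M; exists 1 => y _; rewrite indicE ger0_norm //; case: (_ \in _).
Qed.

Definition bsupp (R : realType) (w : R * R * R -> R) : Prop :=
  exists M, forall y, ~ box M y -> w y = 0.

Lemma bsuppMl (R : realType) (v w : R * R * R -> R) :
  bsupp w -> bsupp (fun y => v y * w y).
Proof. by move=> [M h]; exists M => y /h ->; rewrite mulr0. Qed.

Lemma bsuppMr (R : realType) (v w : R * R * R -> R) :
  bsupp v -> bsupp (fun y => v y * w y).
Proof. by move=> [M h]; exists M => y /h ->; rewrite mul0r. Qed.

Lemma bsuppD (R : realType) (v w : R * R * R -> R) :
  bsupp v -> bsupp w -> bsupp (fun y => v y + w y).
Proof.
move=> [M h] [M' h']; exists (Num.max M M') => y hy.
rewrite h ?h' ?addr0 // => yM; apply: hy.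
  by apply: box_le yM; rewrite le_max lexx orbT.
by apply: box_le yM; rewrite le_max lexx.
Qed.

Lemma locintD (R : realType) (f g : R * R * R -> R) :
  locint f -> locint g -> locint (fun y => f y + g y).
Proof.
move=> [mf lf] [mg lg]; split; first exact: measurable_funD.
by move=> M; exact: (integrableD (measurable_box M) (lf M) (lg M)).
Qed.

Lemma locintB (R : realType) (f g : R * R * R -> R) :
  locint f -> locint g -> locint (fun y => f y - g y).
Proof.
move=> [mf lf] [mg lg]; split; first exact: measurable_funB.
by move=> M; exact: (integrableB (measurable_box M) (lf M) (lg M)).
Qed.

Section pairing.
Variables (R : realType) (h : R * R * R -> R).
Hypothesis lh : locint h.

Lemma pair_integrable (w : R * R * R -> R) : locbd w -> bsupp w ->
  (vol R).-integrable setT (EFin \o (fun y => h y * w y)).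
Proof.
move=> [mw bw] [M w0]; have [C wC] := bw M.
exact: (@locint_integrableM _ _ _ C M).
Qed.

Lemma pairD (v w : R * R * R -> R) :
  locbd v -> bsupp v -> locbd w -> bsupp w ->
  \int[vol R]_y (h y * (v y + w y)) =
  \int[vol R]_y (h y * v y) + \int[vol R]_y (h y * w y).
Proof.
move=> lv sv lw sw; under eq_Rintegral do rewrite mulrDr.
by rewrite RintegralD //; exact: pair_integrable.
Qed.

Lemma pairZ (c : R) (w : R * R * R -> R) : locbd w -> bsupp w ->
  \int[vol R]_y (h y * (c * w y)) = c * \int[vol R]_y (h y * w y).
Proof.
move=> lw sw; under eq_Rintegral do rewrite mulrCA.
by rewrite RintegralZl //; exact: pair_integrable.
Qed.

Lemma pairB (v w : R * R * R -> R) :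
  locbd v -> bsupp v -> locbd w -> bsupp w ->
  \int[vol R]_y (h y * (v y - w y)) =
  \int[vol R]_y (h y * v y) - \int[vol R]_y (h y * w y).
Proof.
move=> lv sv lw sw; under eq_Rintegral do rewrite mulrBr.
by rewrite RintegralB //; exact: pair_integrable.
Qed.

End pairing.

Lemma pairBl (R : realType) (f g w : R * R * R -> R) :
  locint f -> locint g -> locbd w -> bsupp w ->
  \int[vol R]_y ((f y - g y) * w y) =
  \int[vol R]_y (f y * w y) - \int[vol R]_y (g y * w y).
Proof.
move=> lf lg lw sw; under eq_Rintegral do rewrite mulrBl.
by rewrite RintegralB //; exact: pair_integrable.
Qed.

(** Every approximation below is an instance of this form of dominated convergence:
C |h| on the box of size M dominates. *)
Lemma pair_cvg_eq0 (R : realType) (h : R * R * R -> R) (lh : locint h)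
    (w : R * R * R -> R) (w_ : nat -> R * R * R -> R) (C M : R) :
  (forall n, locbd (w_ n)) -> measurable_fun [set: space R] w ->
  (forall n y, box M y -> `|w_ n y| <= C) ->
  (forall n y, ~ box M y -> w_ n y = 0) ->
  {ae vol R, forall y, w_ n y @[n --> \oo] --> w y} ->
  (forall n, \int[vol R]_y (h y * w_ n y) = 0) ->
  \int[vol R]_y (h y * w y) = 0.
Proof.
move=> lw_ mw wC w0 w_w hw0.
have mw_ n : measurable_fun [set: space R] (w_ n) by have [] := lw_ n.
have [mh ih] := lh.
have mhw_ n : measurable_fun [set: space R] (fun y => (h y * w_ n y)%:E).
  by apply/measurable_EFinP; exact: measurable_funM.
have mhw : measurable_fun [set: space R] (fun y => (h y * w y)%:E).
  by apply/measurable_EFinP; exact: measurable_funM.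
have mC : measurable_fun [set: space R] (fun y => C * \1_(box M : set (space R)) y : R).
  by apply: measurable_funM => //; apply: measurable_indic; exact: measurable_box.
have iC : (vol R).-integrable setT
    (EFin \o (fun y => `|h y * (C * \1_(box M : set (space R)) y)|)).
  apply: (@integrable_norm _ _ _ (vol R) setT).
  apply: (@locint_integrableM _ h _ `|C| M lh mC) => y yM.
    by rewrite indicE mem_set // mulr1.
  by rewrite indicE memNset // mulr0.
have hw : {ae vol R, forall y, setT y ->
    (h y * w_ n y)%:E @[n --> \oo] --> (h y * w y)%:E}.
  apply: filterS w_w => y wy _; apply: cvg_EFin; first exact: nearW.
  by apply: cvgM => //; exact: cvg_cst.
have hb : {ae vol R, forall y (n : nat), setT y ->
    (`|(h y * w_ n y)%:E| <= (`|h y * (C * \1_(box M : set (space R)) y)|)%:E)%E}.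
  apply: aeW => y n _; rewrite lee_fin !normrM ler_wpM2l //.
  have [yM|yM] := pselect (box M y).
    rewrite indicE mem_set // normr1 mulr1.
    by rewrite (le_trans (wC n y yM)) // ler_norm.
  by rewrite w0 // normr0 mulr_ge0.
have [_ _ cv] := dominated_convergence measurableT mhw_ mhw hw iC hb.
suff : (\int[vol R]_y (h y * w y)%:E = 0)%E by rewrite /Rintegral => ->.
have E0 n : (\int[vol R]_y (h y * w_ n y)%:E = 0)%E.
  rewrite -[LHS]fineK; first by have := hw0 n; rewrite /Rintegral => ->.
  have H := @locint_integrableM _ _ _ C M lh (mw_ n) (wC n) (w0 n).
  exact: (@integrable_fin_num _ _ _ (vol R) setT measurableT _ H).
move: cv; under eq_fun do rewrite E0.
move=> cv; apply: (cvg_unique (@ereal_hausdorff R) cv).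
exact: cvg_cst.
Qed.

(** * A Dynkin argument *)

Lemma indic_cvg_nd (R : realType) (T : Type) (F : nat -> set T) (y : T) :
  nondecreasing_seq F -> \1_(F n) y @[n --> \oo] --> (\1_(\bigcup_n F n) y : R).
Proof.
move=> ndF; have [[N _ FN]|nF] := pselect ((\bigcup_n F n) y).
  rewrite [X in _ --> X]indicE mem_set; last by exists N.
  apply: cvg_near_cst; exists N => // n /= Nn.
  by rewrite indicE mem_set //; have /subsetPset := ndF _ _ Nn; apply.
rewrite [X in _ --> X]indicE memNset //.
apply: cvg_near_cst; apply: nearW => n.
by rewrite indicE memNset // => Fn; apply: nF; exists n.
Qed.

(** The measurable sets E over whose preimage h * w integrates to zero form a
lambda-system. *)
Lemma pair_dynkin (R : realType) (h w : R * R * R -> R)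
    (T : space R -> space R) :
  locint h -> locbd w -> bsupp w -> measurable_fun setT T ->
  (forall a b c,
    \int[vol R]_y (h y * (w y * \1_(T @^-1` orthant a b c) y)) = 0) ->
  forall E : set (space R), measurable E ->
  \int[vol R]_y (h y * (w y * \1_(T @^-1` E) y)) = 0.
Proof.
move=> lh lw sw mT h0 E mE.
have mpre (A : set (space R)) : measurable A -> measurable (T @^-1` A).
  by move=> mA; rewrite -[X in measurable X]setTI; exact: mT.
have [M wM] := sw; have [mw bw] := lw; have [C wC] := bw M.
have lim (F : nat -> set (space R)) : nondecreasing_seq F ->
    (forall n, measurable (F n)) ->
    (forall n, \int[vol R]_y (h y * (w y * \1_(T @^-1` F n) y)) = 0) ->
    \int[vol R]_y (h y * (w y * \1_(T @^-1` (\bigcup_n F n)) y)) = 0.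
  move=> ndF mF F0.
  apply: (@pair_cvg_eq0 R h lh _
    (fun n y => w y * \1_(T @^-1` F n) y) `|C| M) => //.
  - by move=> n; apply: locbdM => //; apply: locbd_indic; exact: mpre.
  - apply: measurable_funM => //; apply: measurable_indic; apply: mpre.
    exact: bigcup_measurable.
  - move=> n y yM; rewrite normrM indicE.
    have := wC y yM; case: (_ \in _); rewrite ?normr1 ?normr0 ?mulr1 ?mulr0 //.
    by move=> /le_trans; apply; exact: ler_norm.
  - by move=> n y /wM ->; rewrite mul0r.
  - apply: aeW => y; apply: cvgM; first exact: cvg_cst.
    exact: (@indic_cvg_nd R _ F (T y)).
pose H : set (set (space R)) := [set A | measurable A /\
  \int[vol R]_y (h y * (w y * \1_(T @^-1` A) y)) = 0].
have mray a b c : measurable (orthant a b c : set (space R)).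
  have [m0 m1 m2] := measurable_coords R.
  have -> : orthant a b c = [set y : space R | y.1.1 < a] `&`
      ([set y | y.1.2 < b] `&` [set y | y.2 < c]).
    by apply/seteqP; split => y; [move=> []|move=> [? []]].
  by apply: measurableI; [|apply: measurableI]; exact: measurable_lt_set.
suff : H E by case.
apply: (@lambda_system_subset _ (@orthants R) (@setI_closed_orthants R) setT H);
  last exact: measurable_sub_orthants.
- split => //.
  + split=> //.
    have bT : \bigcup_n (orthant n%:R n%:R n%:R : set (space R)) = setT.
      apply/seteqP; split => // y _.
      have [n [h1 h2]] := ex_nat_gt2 y.1.1 y.1.2.
      have [m [h3 h4]] := ex_nat_gt2 (n%:R) y.2.
      exists m => //; split => //; exact: lt_trans h3.
    rewrite -[X in T @^-1` X]bT; apply: lim => // m n mn; apply/subsetPset => y [a b c].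
    have mnR : m%:R <= n%:R :> R by rewrite ler_nat.
    by split; exact: lt_le_trans mnR.
  + move=> A B BA [mA iA] [mB iB]; split; first exact: measurableD.
    have E1 y : w y * \1_(T @^-1` (A `\` B)) y =
        w y * \1_(T @^-1` A) y - w y * \1_(T @^-1` B) y.
      rewrite -mulrBr; congr (_ * _); rewrite !indicE.
      have [yB|yB] := pselect (B (T y)).
        by rewrite memNset ?mem_set ?subrr //; [exact: BA|move=> []].
      rewrite (memNset (_ : ~ (T @^-1` B) y)) // subr0.
      have [yA|yA] := pselect (A (T y)); first by rewrite !mem_set.
      by rewrite !memNset // => -[].
    under eq_Rintegral do rewrite E1.
    rewrite pairB ?iA ?iB ?subrr //.
    * by apply: locbdM => //; apply: locbd_indic; exact: mpre.
    * exact: bsuppMr.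
    * by apply: locbdM => //; apply: locbd_indic; exact: mpre.
    * exact: bsuppMr.
  + move=> F ndF HF; split; first by apply: bigcup_measurable => n _; case: (HF n).
    by apply: lim => // n; case: (HF n).
- by move=> _ [a [b [c ->]]]; split => //; exact: h0.
- by [].
Qed.

(** If h is a function of the coordinates T, then so is its sign, and the Dynkin
argument applies to the sets h < 0 and h >= 0; the integral of |h * w| is
the difference of two vanishing integrals. *)
Lemma ae_eq0_dynkin (R : realType) (h w g : R * R * R -> R)
    (T : space R -> space R) :
  locint h -> locbd w -> bsupp w -> (forall y, 0 <= w y) ->
  measurable_fun setT T -> measurable_fun [set: space R] g ->
  {ae vol R, forall y, h y = g (T y)} ->
  (forall a b c,
    \int[vol R]_y (h y * (w y * \1_(T @^-1` orthant a b c) y)) = 0) ->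
  {ae vol R, forall y, h y * w y = 0}.
Proof.
move=> lh lw sw w0 mT mg hg h0.
have mpre (A : set (space R)) : measurable A -> measurable (T @^-1` A).
  by move=> mA; rewrite -[X in measurable X]setTI; exact: mT.
pose N := [set z : space R | g z < 0].
have mN : measurable N by exact: measurable_lt_set.
have mP : measurable (~` N) by exact: measurableC.
have iP := pair_dynkin lh lw sw mT h0 mP.
have iN := pair_dynkin lh lw sw mT h0 mN.
have ihw := pair_integrable lh lw sw.
have mhw : measurable_fun [set: space R] (fun y => (h y * w y)%:E).
  exact: measurable_int ihw.
have absE : {ae vol R, forall y, h y * (w y * \1_(T @^-1` (~` N)) y -
    w y * \1_(T @^-1` N) y) = `|h y * w y|}.
  apply: filterS hg => y hgy; rewrite -mulrBr mulrA !indicE.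
  have [yN|yN] := ltP (g (T y)) 0.
    have TN : N (T y) by [].
    rewrite (memNset (_ : ~ (T @^-1` (~` N)) y)) ?(mem_set (_ : (T @^-1` N) y)) //.
    rewrite /= mulr0n sub0r mulrN1 ler0_norm //.
    by rewrite hgy mulr_le0_ge0 // ltW.
  have TN : ~ N (T y) by rewrite /N /= ltNge yN.
  rewrite (mem_set (_ : (T @^-1` (~` N)) y)) ?(memNset (_ : ~ (T @^-1` N) y)) //.
  by rewrite /= mulr0n subr0 mulr1 ger0_norm // hgy mulr_ge0.
(* v is w times the sign of h *)
pose v y := w y * \1_(T @^-1` (~` N)) y - w y * \1_(T @^-1` N) y.
have lA (A : set (space R)) : measurable A -> locbd (fun y => w y * \1_(T @^-1` A) y).
  by move=> mA; apply: locbdM => //; apply: locbd_indic; exact: mpre.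
have iv : \int[vol R]_y (h y * v y) = 0.
  by rewrite /v pairB ?iP ?iN ?subrr //; (exact: lA || exact: bsuppMr).
have lv : locbd v by apply: locbdD; [exact: lA|apply: locbdN; exact: lA].
have sv : bsupp v.
  by have [M hM] := sw; exists M => y /hM wy; rewrite /v wy !mul0r subrr.
have ihv := pair_integrable lh lv sv.
have ev : (\int[vol R]_y (h y * v y)%:E = 0)%E.
  rewrite -[LHS]fineK; first by have := iv; rewrite /Rintegral => ->.
  exact: (@integrable_fin_num _ _ _ (vol R) setT measurableT _ ihv).
have : (\int[vol R]_y `|(h y * w y)%:E| = 0)%E.
  rewrite -ev; apply: ae_eq_integral => //.
  - exact: measurableT_comp.
  - exact: measurable_int ihv.
  - by apply: filterS absE => y hy _; rewrite -/(v y) in hy; rewrite hy.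
move/(ae_eq_integral_abs (vol R) measurableT mhw).
by apply: filterS => y /(_ I) [].
Qed.

Lemma pair_ae_eq (R : realType) (h k w : R * R * R -> R) :
  locint h -> locint k -> locbd w -> bsupp w ->
  {ae vol R, forall y, h y = k y} ->
  \int[vol R]_y (h y * w y) = \int[vol R]_y (k y * w y).
Proof.
move=> lh lk lw sw hk; congr fine; apply: ae_eq_integral => //.
- exact: measurable_int (pair_integrable lh lw sw).
- exact: measurable_int (pair_integrable lk lw sw).
- by apply: filterS hk => y -> _.
Qed.

Lemma indic_le1 (R : realType) (T : Type) (A : set T) y : \1_A y <= 1 :> R.
Proof. by rewrite indicE; case: (y \in A). Qed.

(** * Balls centred on the plane *)

(** The square of the distance makes the dependence on the centre polynomial, which
is what the differentiation in the centre relies on. *)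
Definition rho (R : realType) (x : R * R) (y : R * R * R) : R :=
  (y.1.1 - x.1) ^+ 2 + (y.1.2 - x.2) ^+ 2 + y.2 ^+ 2.

Definition vball (R : realType) (x : R * R) (t : R) : set (space R) :=
  [set y | rho x y < t].

Lemma rho_ge0 (R : realType) (x : R * R) y : 0 <= rho x y.
Proof. by rewrite !addr_ge0 // sqr_ge0. Qed.

Lemma locbd_rho (R : realType) (x : R * R) : locbd (rho x).
Proof.
have [l0 l1 l2] := locbd_coord R.
apply: locbdD; last exact: locbdX.
apply: locbdD; apply: (@locbdX _ _ 2).
  exact: (locbdD l0 (locbd_cst (- x.1))).
exact: (locbdD l1 (locbd_cst (- x.2))).
Qed.

Lemma measurable_vball (R : realType) (x : R * R) t : measurable (vball x t).
Proof. by apply: measurable_lt_set; have [] := locbd_rho x. Qed.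

Lemma locbd_vball (R : realType) (x : R * R) t :
  locbd (\1_(vball x t) : R * R * R -> R).
Proof. by apply: locbd_indic; exact: measurable_vball. Qed.

(** A bound without square roots, enough to place balls in boxes. *)
Lemma sqr_lt_bound (R : realFieldType) (a t : R) : a ^+ 2 < t -> `|a| <= 1 + t.
Proof.
rewrite -real_normK ?num_real // => h.
have := normr_ge0 a; move: h; set b := `|a|; nra.
Qed.

Lemma vball_box (R : realType) (x : R * R) (t M : R) :
  `|x.1| + `|x.2| + 1 + t <= M -> vball x t `<=` box M.
Proof.
move=> hM y; rewrite /vball /rho /= => hy.
have a0 := sqr_ge0 (y.1.1 - x.1); have a1 := sqr_ge0 (y.1.2 - x.2).
have a2 := sqr_ge0 y.2.
have b0 : `|y.1.1 - x.1| <= 1 + t by apply: sqr_lt_bound; lra.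
have b1 : `|y.1.2 - x.2| <= 1 + t by apply: sqr_lt_bound; lra.
have b2 : `|y.2| <= 1 + t by apply: sqr_lt_bound; lra.
have c0 : `|y.1.1| <= `|y.1.1 - x.1| + `|x.1| by rewrite -{1}[y.1.1](subrK x.1) ler_normD.
have c1 : `|y.1.2| <= `|y.1.2 - x.2| + `|x.2| by rewrite -{1}[y.1.2](subrK x.2) ler_normD.
have n1 := normr_ge0 x.1; have n2 := normr_ge0 x.2.
by split; lra.
Qed.

Lemma indic_vball_out (R : realType) (x : R * R) (t M : R) y :
  `|x.1| + `|x.2| + 1 + t <= M -> ~ box M y -> \1_(vball x t) y = 0 :> R.
Proof. by move=> hM yM; rewrite indicE memNset // => /(vball_box hM). Qed.

Lemma bsupp_vball (R : realType) (x : R * R) t :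
  bsupp (\1_(vball x t) : R * R * R -> R).
Proof.
by exists (`|x.1| + `|x.2| + 1 + t) => y; exact: indic_vball_out.
Qed.

(** The integral of the indicator of [vball x s] over s in [0, t].  Unlike that
indicator it is Lipschitz in the centre x. *)
Definition cone (R : realType) (x : R * R) (t : R) (y : R * R * R) : R :=
  Num.max 0 (t - rho x y).

Lemma cone_out (R : realType) (x : R * R) (t : R) y :
  ~ vball x t y -> cone x t y = 0.
Proof.
move=> /negP; rewrite -leNgt => h; rewrite /cone; apply/max_idPl.
by rewrite subr_le0.
Qed.

Lemma cone_in (R : realType) (x : R * R) (t : R) y :
  rho x y <= t -> cone x t y = t - rho x y.
Proof. by move=> h; rewrite /cone; apply/max_idPr; rewrite subr_ge0. Qed.

Lemma locbd_cone (R : realType) (x : R * R) t : locbd (cone x t).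
Proof.
have [mc bc] : locbd (fun y => t + - rho x y).
  by apply: locbdD; [exact: locbd_cst|apply: locbdN; exact: locbd_rho].
split; first by apply: measurable_maxr => //; exact: measurable_cst.
move=> M; have [C hC] := bc M; exists C => y /hC; rewrite /cone.
by case: (leP 0 (t - rho x y)) => // h; rewrite normr0; exact: le_trans.
Qed.

Lemma bsupp_cone (R : realType) (x : R * R) t : bsupp (cone x t).
Proof.
exists (`|x.1| + `|x.2| + 1 + t) => y yM; apply: cone_out.
by move=> /(@vball_box _ _ _ _ (lexx _)).
Qed.

(** * From balls to cones *)

(** The property that is propagated from f to its products with polynomials and
indicators of half-spaces. *)
Definition ball_null (R : realType) (Gamma : set (R * R)) (T : R)
    (h : R * R * R -> R) : Prop :=
  locint h /\ forall x t, Gamma x -> 0 < t -> t < T ->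
    \int[vol R]_y (h y * \1_(vball x t) y) = 0.

(** A Riemann sum for [cone], made of indicators of balls. *)
Definition steps (R : realType) (x : R * R) (d : R) (n : nat) (y : R * R * R) : R :=
  \sum_(j < n) d * \1_(vball x (j.+1%:R * d)) y.

Lemma stepsS (R : realType) (x : R * R) (d : R) n y :
  steps x d n.+1 y = steps x d n y + d * \1_(vball x (n.+1%:R * d)) y.
Proof. by rewrite /steps big_ord_recr. Qed.

Lemma locbd_steps (R : realType) (x : R * R) d n : locbd (steps x d n).
Proof.
elim: n => [|n IH].
  have -> : steps x d 0 = (fun=> 0) by apply/funext => y; rewrite /steps big_ord0.
  exact: locbd_cst.
have -> : steps x d n.+1 =
    (fun y => steps x d n y + d * \1_(vball x (n.+1%:R * d)) y).
  by apply/funext => y; rewrite stepsS.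
by apply: locbdD => //; apply: locbdM; [exact: locbd_cst|exact: locbd_vball].
Qed.

Lemma bsupp_steps (R : realType) (x : R * R) d n : bsupp (steps x d n).
Proof.
elim: n => [|n IH].
  by exists 0 => y _; rewrite /steps big_ord0.
have -> : steps x d n.+1 =
    (fun y => steps x d n y + d * \1_(vball x (n.+1%:R * d)) y).
  by apply/funext => y; rewrite stepsS.
by apply: bsuppD => //; apply: bsuppMl; exact: bsupp_vball.
Qed.

(** The Riemann sum is within one step of the cone, and both vanish outside the
largest ball. *)
Lemma steps_cone (R : realType) (x : R * R) (d : R) n y : 0 < d ->
  `|cone x (n%:R * d) y - steps x d n y| <= d * \1_(vball x (n%:R * d)) y.
Proof.
move=> d0; elim: n => [|n IH].
  have h : ~ vball x (0%:R * d) y.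
    by rewrite /vball /= mul0r; apply/negP; rewrite -leNgt rho_ge0.
  by rewrite cone_out // /steps big_ord0 subr0 normr0 mulr_ge0 // ltW.
rewrite stepsS; move: IH; have E : n.+1%:R * d = n%:R * d + d.
  by rewrite -natr1 mulrDl mul1r.
have [h1|h1] := pselect (vball x (n%:R * d) y).
  have h2 : vball x (n.+1%:R * d) y by move: h1; rewrite /vball /= E; lra.
  rewrite !indicE !mem_set // !cone_in ?(ltW h1) ?(ltW h2) //= !mulr1 E.
  by congr (`|_| <= _); ring.
rewrite (cone_out h1) indicE memNset //= mulr0 sub0r normrN normr_le0 => /eqP ->.
have [h2|h2] := pselect (vball x (n.+1%:R * d) y).
  rewrite !indicE !mem_set // cone_in ?(ltW h2) //= !mulr1.
  move/negP : h1; rewrite -leNgt; move: h2; rewrite /vball /= E.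
  move=> h2 h1; rewrite ler_norml; apply/andP; split; lra.
by rewrite cone_out // indicE memNset //= mulr0 addr0 subrr normr0.
Qed.

Lemma ball_null_cone (R : realType) (Gamma : set (R * R)) (T : R)
    (h : R * R * R -> R) (x : R * R) (t : R) :
  ball_null Gamma T h -> Gamma x -> 0 < t -> t < T ->
  \int[vol R]_y (h y * cone x t y) = 0.
Proof.
move=> [lh gh] Gx t0 tT.
pose d n : R := t / n.+1%:R.
have d0 n : 0 < d n by rewrite divr_gt0.
have dt n : n.+1%:R * d n = t by rewrite mulrC divfK.
have dle n : d n <= t by rewrite ler_pdivrMr // ler_peMr ?ler1n // ltW.
pose M := `|x.1| + `|x.2| + 1 + t.
have [mc bc] := locbd_cone x t; have [C hC] := bc M.
have st n y : `|cone x t y - steps x (d n) n.+1 y| <= d n * \1_(vball x t) y.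
  by have := @steps_cone R x (d n) n.+1 y (d0 n); rewrite dt.
apply: (@pair_cvg_eq0 R h lh _ (fun n => steps x (d n) n.+1) (C + t) M).
- by move=> n; exact: locbd_steps.
- by [].
- move=> n y yM.
  have s1 := st n y.
  have -> : steps x (d n) n.+1 y =
      cone x t y - (cone x t y - steps x (d n) n.+1 y) by ring.
  rewrite (le_trans (ler_normB _ _)) // lerD ?hC // (le_trans s1) //.
  rewrite (le_trans _ (dle n)) // ler_piMr ?(ltW (d0 n)) // indic_le1.
- move=> n y yM; have := st n y.
  rewrite (indic_vball_out (lexx _) yM) mulr0 cone_out; last by move=> /(vball_box (lexx _)).
  by rewrite sub0r normrN normr_le0 => /eqP.
- apply: aeW => y; apply/cvgrPdist_le => e e0.
  have : t * harmonic n @[n --> \oo] --> t * 0.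
    by apply: cvgM; [exact: cvg_cst|exact: cvg_harmonic].
  rewrite mulr0 => /cvgr0_norm_le /(_ _ e0); apply: filterS => n dn.
  rewrite (le_trans (st n y)) // (le_trans _ dn) //.
  rewrite ger0_norm ?mulr_ge0 ?(ltW t0) //; last by rewrite /harmonic /= invr_ge0.
  rewrite -/(d n) ler_piMr ?(ltW (d0 n)) // indic_le1.
- move=> n.
  have : (n.+1 <= n.+1)%N by [].
  move: {-2}(n.+1) => k; elim: k => [|k IH] kn.
    rewrite (_ : (fun y => h y * steps x (d n) 0 y) = cst 0); last first.
      by apply/funext => y; rewrite /steps big_ord0 mulr0.
    by rewrite Rintegral_cst // mul0r.
  under eq_Rintegral do rewrite stepsS.
  rewrite pairD //; last 4 first.
  + exact: locbd_steps.
  + exact: bsupp_steps.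
  + by apply: locbdM; [exact: locbd_cst|exact: locbd_vball].
  + by apply: bsuppMl; exact: bsupp_vball.
  rewrite IH ?(ltnW kn) // pairZ //; [|exact: locbd_vball|exact: bsupp_vball].
  rewrite gh ?mulr0 ?addr0 //; first by rewrite mulr_gt0.
  rewrite (le_lt_trans _ tT) // -[leRHS](dt n) ler_pM2r // ler_nat //.
Qed.

(** * Differentiation in the centre *)

(** The measure of A is the integral of the lengths of its vertical sections. *)
Lemma vol_null_xsection (R : realType) (A : set (space R)) :
  measurable A -> (forall p, @lebesgue_measure R (xsection A p) = 0%E) ->
  vol R A = 0%E.
Proof.
move=> mA h0.
have -> : vol R A = (\int[@lebesgue_measure R \x @lebesgue_measure R]_p
    (@lebesgue_measure R \o xsection A) p)%E by [].
by apply: integral0_eq => p _ /=; exact: h0.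
Qed.

(** A vertical line meets a sphere in at most two points. *)
Lemma sphere_null (R : realType) (x : R * R) (t : R) :
  {ae vol R, forall y, rho x y != t}.
Proof.
have [mr _] := locbd_rho x.
have mS : measurable ([set y | rho x y = t] : set (space R)).
  have -> : [set y | rho x y = t] = setT `&` rho x @^-1` [set t].
    by apply/seteqP; split => y /=; [|move=> []].
  by apply: mr => //; exact: measurable_set1.
exists [set y | rho x y = t]; split => //; last first.
  by move=> y /= /negP; rewrite negbK => /eqP.
apply: vol_null_xsection => // p.
pose s := Num.sqrt (t - (p.1 - x.1) ^+ 2 - (p.2 - x.2) ^+ 2).
have sub : xsection [set y : space R | rho x y = t] p `<=` [set s; - s].
  move=> z; rewrite /xsection /= inE /rho /= => e.
  have : `|z| = s by rewrite -sqrtr_sqr /s; congr Num.sqrt; rewrite -e; ring.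
  have [z0|z0] := leP 0 z; first by rewrite ger0_norm // => ->; left.
  by rewrite ltr0_norm // => <-; right; rewrite opprK.
have : @lebesgue_measure R [set s; - s] = 0%E.
  apply: countable_lebesgue_measure0.
  by apply: finite_set_countable; exact: finite_set2.
move=> m0; apply/eqP; rewrite -measure_le0 -m0; apply: le_measure => //.
- by rewrite inE; exact: measurable_xsection.
- by rewrite inE; apply: measurableU; exact: measurable_set1.
Qed.

Lemma open_ball2 (R : realType) (Gamma : set (R * R)) (x : R * R) :
  open Gamma -> Gamma x -> exists2 e : R, 0 < e & forall z : R * R,
    `|x.1 - z.1| < e -> `|x.2 - z.2| < e -> Gamma z.
Proof.
move=> oG Gx; have /nbhs_ballP [e /= e0 he] := open_nbhs_nbhs (conj oG Gx).
by exists e => // z z1 z2; apply: he.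
Qed.

Definition lin (R : realType) (v : R * R) (y : R * R * R) : R :=
  v.1 * y.1.1 + v.2 * y.1.2.

Lemma locbd_lin (R : realType) (v : R * R) : locbd (lin v).
Proof.
have [l0 l1 l2] := locbd_coord R.
by apply: locbdD; apply: locbdM => //; exact: locbd_cst.
Qed.

Lemma max0_lip (R : realDomainType) (a b : R) :
  `|Num.max 0 a - Num.max 0 b| <= `|a - b|.
Proof.
case: (leP 0 a) => ha; case: (leP 0 b) => hb //.
- by rewrite subr0 (ger0_norm ha) (le_trans _ (ler_norm _)) // lerBrDr; lra.
- by rewrite sub0r normrN (ger0_norm hb) distrC (le_trans _ (ler_norm _)) //; lra.
- by rewrite subrr normr0.
Qed.

(** Move the centre from x to x + s v.  The difference quotients of the cone are
bounded, uniformly in s, and converge off the sphere rho x y = t to the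
indicator of the ball times L y = 2 (v . (y' - x)).  Each of them pairs to zero
with h, hence so does the limit, and the part of L that is constant in y drops
out because h itself integrates to zero over the ball. *)
Lemma ball_null_lin (R : realType) (Gamma : set (R * R)) (T : R)
    (h : R * R * R -> R) (v : R * R) : open Gamma ->
  ball_null Gamma T h -> ball_null Gamma T (fun y => h y * lin v y).
Proof.
move=> oG ghh; have [lh gh] := ghh.
have [ml bl] := locbd_lin v.
split; first exact: locintM.
move=> x t Gx t0 tT.
have [eps eps0 Geps] := open_ball2 oG Gx.
(* e <= 1 is small enough for x + s v to stay in Gamma when s <= e *)
pose den := eps + 1 + `|v.1| + `|v.2|.
have v10 := normr_ge0 v.1; have v20 := normr_ge0 v.2.
have den0 : 0 < den by rewrite /den; lra.
pose e := eps / den.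
have e0 : 0 < e by rewrite divr_gt0.
have e1 : e <= 1 by rewrite ler_pdivrMr // mul1r /den; lra.
pose s n : R := e * harmonic n.
have har0 n : 0 < harmonic n :> R by rewrite /harmonic /= invr_gt0.
have har1 n : harmonic n <= 1 :> R.
  by rewrite /harmonic /= invf_le1 // ler1n.
have s0 n : 0 < s n by rewrite mulr_gt0.
have se n : s n <= e by rewrite ler_piMr // ltW.
have s1 n : s n <= 1 by exact: le_trans e1.
have s_0 : s n @[n --> \oo] --> 0.
  by rewrite -(mulr0 e); apply: cvgM; [exact: cvg_cst|exact: cvg_harmonic].
pose xs n : R * R := (x.1 + s n * v.1, x.2 + s n * v.2).
have Gxs n : Gamma (xs n).
  have ee : e * den = eps by rewrite divfK // gt_eqF.
  apply: Geps; rewrite /xs /= opprD addrA subrr sub0r normrN normrM gtr0_norm //.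
    rewrite (le_lt_trans (ler_wpM2r v10 (se n))) // -ee ltr_pM2l // /den; lra.
  rewrite (le_lt_trans (ler_wpM2r v20 (se n))) // -ee ltr_pM2l // /den; lra.
pose q := v.1 ^+ 2 + v.2 ^+ 2.
have q0 : 0 <= q by rewrite addr_ge0 // sqr_ge0.
pose L y := 2 * (lin v y - (v.1 * x.1 + v.2 * x.2)).
have lL : locbd L.
  apply: locbdM; first exact: locbd_cst.
  by apply: locbdD; [exact: locbd_lin|exact: locbd_cst].
have rhoE n y : rho (xs n) y = rho x y - s n * L y + s n ^+ 2 * q.
  by rewrite /rho /xs /L /lin /q /=; ring.
pose w n y := (s n)^-1 * (cone (xs n) t y - cone x t y).
have lw n : locbd (w n).
  apply: locbdM; first exact: locbd_cst.
  by apply: locbdD; [|apply: locbdN]; exact: locbd_cone.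
pose M := (`|x.1| + `|v.1|) + (`|x.2| + `|v.2|) + 1 + t.
have Mx : `|x.1| + `|x.2| + 1 + t <= M by rewrite /M; lra.
have Mxs n : `|(xs n).1| + `|(xs n).2| + 1 + t <= M.
  rewrite /xs /= /M !lerD2r; apply: lerD; rewrite (le_trans (ler_normD _ _)) // lerD2l.
    by rewrite normrM gtr0_norm // ler_piMl.
  by rewrite normrM gtr0_norm // ler_piMl.
have wb n y : `|w n y| <= `|L y| + q.
  rewrite /w normrM gtr0_norm ?invr_gt0 // ler_pdivrMl //.
  rewrite (le_trans (max0_lip _ _)) //.
  have -> : t - rho (xs n) y - (t - rho x y) = s n * (L y - s n * q).
    by rewrite rhoE; ring.
  rewrite normrM gtr0_norm // ler_pM2l // (le_trans (ler_normB _ _)) // lerD2l.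
  by rewrite ger0_norm ?ler_piMl // mulr_ge0 // ltW.
have key : \int[vol R]_y (h y * (\1_(vball x t) y * L y)) = 0.
  have [mL bL] := lL; have [C hC] := bL M.
  (* the limit of the difference quotients, under the bound wb *)
  apply: (@pair_cvg_eq0 R h lh _ w (C + q) M) => //.
  - by apply: measurable_funM => //; have [] := locbd_vball x t.
  - by move=> n y yM; rewrite (le_trans (wb n y)) // lerD2r hC.
  - move=> n y yM; rewrite /w !cone_out ?subrr ?mulr0 //.
    + by move=> /(vball_box Mx).
    + by move=> /(vball_box (Mxs n)).
  - apply: filterS (sphere_null x t) => y ny.
    pose K := `|L y| + q.
    have K0 : 0 <= K by rewrite addr_ge0.
    have dlt0 : 0 < `|t - rho x y| by rewrite normr_gt0 subr_eq0 eq_sym.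
    have near1 : \forall n \near \oo, s n * K < `|t - rho x y|.
      have : s n * K @[n --> \oo] --> 0 * K by apply: cvgM => //; exact: cvg_cst.
      by rewrite mul0r => /cvgr_lt; apply.
    have bnd n : `|s n * L y - s n ^+ 2 * q| <= s n * K.
      rewrite (_ : _ - _ = s n * (L y - s n * q)); last by ring.
      rewrite normrM gtr0_norm // ler_pM2l // (le_trans (ler_normB _ _)) // lerD2l.
      by rewrite ger0_norm ?ler_piMl // mulr_ge0 // ltW.
    have [yin|yout] := ltP (rho x y) t.
      rewrite indicE mem_set //= mul1r.
      have lim : L y - s n * q @[n --> \oo] --> L y.
        rewrite -[X in _ --> X]subr0; apply: cvgB; first exact: cvg_cst.
        by rewrite -(mul0r q); apply: cvgM => //; exact: cvg_cst.
      apply: cvg_trans lim; apply: near_eq_cvg.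
      apply: filterS near1 => n; rewrite gtr0_norm ?subr_gt0 // => hn.
      have := bnd n; rewrite ler_norml => /andP[b1 b2].
      rewrite /w !cone_in ?(ltW yin) //; last by rewrite rhoE; lra.
      by rewrite rhoE; field; rewrite gt_eqF.
    have {}yout : t < rho x y by rewrite lt_neqAle eq_sym ny.
    rewrite indicE memNset //=; last by rewrite /vball /=; apply/negP; rewrite -leNgt ltW.
    rewrite mul0r; apply: cvg_near_cst.
    apply: filterS near1 => n; rewrite ltr0_norm ?subr_lt0 // => hn.
    have := bnd n; rewrite ler_norml => /andP[b1 b2].
    rewrite /w !cone_out ?subrr ?mulr0 //; rewrite /vball /=; apply/negP; rewrite -leNgt.
      exact: ltW.
    by rewrite rhoE; lra.
  - move=> n; rewrite /w pairZ //; last 2 first.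
    + by apply: locbdD; [|apply: locbdN]; exact: locbd_cone.
    + exists M => y yM; rewrite !cone_out ?subrr //.
        by move=> /(vball_box Mx).
      by move=> /(vball_box (Mxs n)).
    rewrite pairB //; try exact: locbd_cone; try exact: bsupp_cone.
    by rewrite !(ball_null_cone ghh) // subrr mulr0.
pose c := v.1 * x.1 + v.2 * x.2.
have : \int[vol R]_y (h y * (2 * (\1_(vball x t) y * lin v y) -
    2 * c * \1_(vball x t) y)) = 0.
  rewrite -key; apply: eq_Rintegral => y _; rewrite /L -/c; ring.
have lB := locbd_vball x t; have sB := bsupp_vball x t.
have lBl : locbd (fun y => \1_(vball x t) y * lin v y).
  by apply: locbdM => //; exact: locbd_lin.
have sBl : bsupp (fun y => \1_(vball x t) y * lin v y) by exact: bsuppMr.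
rewrite pairB //; last 4 first.
- by apply: locbdM => //; exact: locbd_cst.
- exact: bsuppMl.
- by apply: locbdM => //; exact: locbd_cst.
- exact: bsuppMl.
rewrite !pairZ // gh // mulr0 subr0 => /eqP; rewrite mulf_eq0 pnatr_eq0 /= => /eqP <-.
by apply: eq_Rintegral => y _; ring.
Qed.

(** * From polynomials to half-spaces *)

Lemma eq_ball_null (R : realType) (Gamma : set (R * R)) (T : R)
    (h k : R * R * R -> R) : h =1 k -> ball_null Gamma T h -> ball_null Gamma T k.
Proof. by move=> /funext ->. Qed.

Lemma ball_nullB (R : realType) (Gamma : set (R * R)) (T : R)
    (h : R * R * R -> R) (v w : R * R * R -> R) :
  locint h -> locbd v -> locbd w ->
  ball_null Gamma T (fun y => h y * v y) -> ball_null Gamma T (fun y => h y * w y) ->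
  ball_null Gamma T (fun y => h y * (v y - w y)).
Proof.
move=> lh lv lw [_ gv] [_ gw]; split.
  by have [mm bb] := locbdD lv (locbdN lw); exact: locintM.
move=> x t Gx t0 tT.
have lB := locbd_vball x t; have sB := bsupp_vball x t.
have := gv _ _ Gx t0 tT; under eq_Rintegral do rewrite -mulrA.
have := gw _ _ Gx t0 tT; under eq_Rintegral do rewrite -mulrA.
move=> Ew Ev.
under eq_Rintegral do rewrite -mulrA mulrBl.
rewrite pairB // ?Ev ?Ew ?subrr //; by [exact: locbdM|exact: bsuppMl].
Qed.

Lemma ball_nullZ (R : realType) (Gamma : set (R * R)) (T c : R)
    (h : R * R * R -> R) :
  ball_null Gamma T h -> ball_null Gamma T (fun y => h y * c).
Proof.
move=> [lh gh]; split.
  by have [mm bb] := locbd_cst c; exact: locintM.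
move=> x t Gx t0 tT; under eq_Rintegral do rewrite -mulrA.
rewrite pairZ // ?gh ?mulr0 //; [exact: locbd_vball|exact: bsupp_vball].
Qed.

Lemma ball_null_affine (R : realType) (Gamma : set (R * R)) (T c : R)
    (h : R * R * R -> R) (v : R * R) : open Gamma ->
  ball_null Gamma T h -> ball_null Gamma T (fun y => h y * (lin v y - c)).
Proof.
move=> oG gh; have [lh _] := gh.
apply: ball_nullB => //; [exact: locbd_lin|exact: locbd_cst|exact: ball_null_lin|exact: ball_nullZ].
Qed.

Lemma ball_null_step_poly (R : realType) (Gamma : set (R * R)) (T c : R)
    (h : R * R * R -> R) (v : R * R) (n k : nat) : open Gamma ->
  ball_null Gamma T h -> ball_null Gamma T (fun y => h y * (1 - (lin v y - c) ^+ n) ^+ k).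
Proof.
move=> oG gh.
have ls : locbd (fun y => lin v y - c).
  by apply: locbdD; [exact: locbd_lin|exact: locbd_cst].
have pw (g : R * R * R -> R) m : ball_null Gamma T g ->
    ball_null Gamma T (fun y => g y * (lin v y - c) ^+ m).
  elim: m => [|m IH] gg; first by apply: eq_ball_null gg => y; rewrite expr0 mulr1.
  by apply: eq_ball_null (ball_null_affine c v oG (IH gg)) => y; rewrite exprSr mulrA.
elim: k => [|k IH]; first by apply: eq_ball_null gh => y; rewrite expr0 mulr1.
have [lI _] := IH.
have : ball_null Gamma T (fun y => (h y * (1 - (lin v y - c) ^+ n) ^+ k) *
    (1 - (lin v y - c) ^+ n)).
  apply: ball_nullB => //; [exact: locbd_cst|exact: locbdX|exact: ball_nullZ|exact: pw].
by apply: eq_ball_null => y; rewrite exprSr mulrA.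
Qed.

Lemma bernoulli_ineq (R : realDomainType) (x : R) (k : nat) :
  -1 <= x -> 1 + k%:R * x <= (1 + x) ^+ k.
Proof.
move=> x1; elim: k => [|k IH]; first by rewrite mul0r addr0 expr0.
have x10 : 0 <= 1 + x by rewrite -lerBlDl sub0r.
rewrite exprSr (le_trans _ (ler_wpM2r x10 IH)) // -natr1.
have := mulr_ge0 (ler0n R k) (sqr_ge0 x); rewrite expr2; nra.
Qed.

(** Bernoulli's inequality twice: (1 - s ^ n) ^ (2 ^ n) >= 1 - (2 s) ^ n settles
s < 1/2, and (1 - s ^ n) ^ (2 ^ n) (1 + s ^ n) ^ (2 ^ n) <= 1 together with
(1 + s ^ n) ^ (2 ^ n) >= (2 s) ^ n settles s > 1/2. *)
Lemma step_poly_cvg (R : realType) (s : R) : 0 <= s <= 1 -> s != 2^-1 ->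
  (1 - s ^+ n) ^+ (2 ^ n) @[n --> \oo] --> ((s < 2^-1)%R%:R : R).
Proof.
move=> /andP[s0 s1] s2.
have sn01 n : 0 <= s ^+ n <= 1 by rewrite exprn_ge0 //= exprn_ile1.
have E n : (2 ^ n)%:R * s ^+ n = (2 * s) ^+ n by rewrite natrX exprMn.
have up n : (1 - s ^+ n) ^+ (2 ^ n) <= 1.
  have /andP[a b] := sn01 n.
  by rewrite exprn_ile1 //; lra.
have [lt|ge] := ltP s 2^-1.
  have c0 : (2 * s) ^+ n @[n --> \oo] --> 0.
    by apply: cvg_expr; rewrite ger0_norm ?mulr_ge0 //; lra.
  have c1 : 1 - (2 * s) ^+ n @[n --> \oo] --> (1 : R).
    rewrite -[X in _ --> X]subr0; apply: cvgB => //; exact: cvg_cst.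
  rewrite mulr1n; apply: (squeeze_cvgr _ c1 (cvg_cst (1 : R))); apply: nearW => n.
  rewrite up andbT -E; have := @bernoulli_ineq R (- s ^+ n) (2 ^ n).
  by rewrite mulrN; apply; have /andP[a b] := sn01 n; lra.
have {}ge : 2^-1 < s by rewrite lt_neqAle eq_sym s2.
have ss : 1 < 2 * s by lra.
have c0 : ((2 * s)^-1) ^+ n @[n --> \oo] --> 0.
  by apply: cvg_expr; rewrite ger0_norm ?invr_ge0 ?mulr_ge0 // invf_lt1 //; lra.
rewrite mulr0n; apply: (squeeze_cvgr _ (cvg_cst (0 : R)) c0); apply: nearW => n.
have /andP[a b] := sn01 n.
rewrite exprn_ge0 ?subr_ge0 //= exprVn -E.
have p0 : 0 < (2 ^ n)%:R * s ^+ n by rewrite E exprn_gt0 //; lra.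
rewrite -[leRHS]mul1r ler_pdivlMr //.
have b1 := @bernoulli_ineq R (s ^+ n) (2 ^ n) (le_trans (lerN10 R) a).
have n0 : 0 <= (1 - s ^+ n) ^+ (2 ^ n) by rewrite exprn_ge0 // subr_ge0.
rewrite (@le_trans _ _ ((1 - s ^+ n) ^+ (2 ^ n) * (1 + s ^+ n) ^+ (2 ^ n))) //.
  by rewrite ler_wpM2l // (le_trans _ b1) // lerDr.
rewrite -exprMn exprn_ile1 //; nra.
Qed.

Lemma vol_null_coord0 (R : realType) (a : R) : {ae vol R, forall y, y.1.1 != a}.
Proof.
have m1 : measurable ([set a] : set R) by exact: measurable_set1.
have e2 := product_measure1E (@lebesgue_measure R) (@lebesgue_measure R)
  m1 measurableT.
have e3 := product_measure1E (@lebesgue_measure R \x @lebesgue_measure R)%E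
  (@lebesgue_measure R) (measurableX m1 measurableT) measurableT.
exists (([set a] `*` setT) `*` setT); split.
- by apply: measurableX => //; exact: measurableX.
- rewrite /=; apply: etrans e3 _; have := e2 => /= ->.
  by rewrite lebesgue_measure_set1 !mul0e.
- by move=> y /= /negP; rewrite negbK => /eqP.
Qed.

Lemma vol_null_coord1 (R : realType) (a : R) : {ae vol R, forall y, y.1.2 != a}.
Proof.
have m1 : measurable ([set a] : set R) by exact: measurable_set1.
have e2 := product_measure1E (@lebesgue_measure R) (@lebesgue_measure R)
  measurableT m1.
have e3 := product_measure1E (@lebesgue_measure R \x @lebesgue_measure R)%E
  (@lebesgue_measure R) (measurableX measurableT m1) measurableT.
exists ((setT `*` [set a]) `*` setT); split.
- by apply: measurableX => //; exact: measurableX.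
- rewrite /=; apply: etrans e3 _; have := e2 => /= ->.
  by rewrite lebesgue_measure_set1 mule0 mul0e.
- by move=> y /= /negP; rewrite negbK => /eqP.
Qed.

(** Within a given ball, an affine change of variable turns lin v y - a into a
function s with values in [0, 1] that equals 1/2 on the bounding plane; then
[step_poly_cvg] applies off that plane. *)
Lemma ball_null_halfspace (R : realType) (Gamma : set (R * R)) (T a : R)
    (h : R * R * R -> R) (v : R * R) : open Gamma ->
  {ae vol R, forall y, lin v y != a} ->
  ball_null Gamma T h ->
  ball_null Gamma T (fun y => h y * \1_[set y : space R | lin v y < a] y).
Proof.
move=> oG na gh; have [lh _] := gh.
have [ml bl] := locbd_lin v.
have mH : measurable [set y : space R | lin v y < a] by exact: measurable_lt_set.
split; first by have [mm bb] := locbd_indic mH; exact: locintM.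
move=> x t Gx t0 tT.
pose M := `|x.1| + `|x.2| + 1 + t.
have [C hC] := bl M.
(* K bounds |lin v y - a| on the box, so lin u y - c = 1/2 + (lin v y - a) / (2 K)
   has values in [0, 1] there *)
pose K := `|C| + `|a| + 1.
have K0 : 0 < K by rewrite /K; have := normr_ge0 C; have := normr_ge0 a; lra.
pose k := (2 * K)^-1.
have k0 : 0 < k by rewrite invr_gt0 mulr_gt0.
pose u : R * R := (k * v.1, k * v.2).
pose c := k * a - 2^-1.
have linE y : lin u y - c = 2^-1 + k * (lin v y - a).
  by rewrite /lin /u /c /=; ring.
have s01 y : box M y -> 0 <= lin u y - c <= 1.
  move=> yM; have := hC y yM; rewrite linE => h1.
  have h2 : `|lin v y - a| <= K.
    rewrite (le_trans (ler_normB _ _)) // /K.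
    have := ler_norm C; lra.
  have h3 : `|k * (lin v y - a)| <= 2^-1.
    rewrite normrM gtr0_norm // (le_trans (ler_wpM2l (ltW k0) h2)) //.
    by rewrite /k invfM -mulrA mulVf ?mulr1 // gt_eqF.
  by move: h3; rewrite ler_norml => /andP[h3 h4]; apply/andP; split; lra.
pose w (n : nat) y := (1 - (lin u y - c) ^+ n) ^+ (2 ^ n) * \1_(vball x t) y.
have lu : locbd (fun y => lin u y - c).
  by apply: locbdD; [exact: locbd_lin|exact: locbd_cst].
rewrite (_ : (fun y => _) = (fun y => h y *
    (\1_[set y : space R | lin v y < a] y * \1_(vball x t) y))); last first.
  by apply/funext => y; rewrite mulrA.
apply: (@pair_cvg_eq0 R h lh _ w 1 M).
- move=> n; apply: locbdM; last exact: locbd_vball.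
  apply: locbdX; apply: locbdD; first exact: locbd_cst.
  by apply: locbdN; exact: locbdX.
- apply: measurable_funM; first exact: measurable_indic.
  by have [] := locbd_vball x t.
- move=> n y yM; have /andP[a0 a1] := s01 y yM.
  have e0 : 0 <= (lin u y - c) ^+ n by rewrite exprn_ge0.
  have e1 : (lin u y - c) ^+ n <= 1 by rewrite exprn_ile1.
  rewrite /w normrM mulr_ile1 //.
    by rewrite normrX exprn_ile1 // ger0_norm; lra.
  by rewrite ger0_norm ?indic_le1 // indicE.
- by move=> n y yM; rewrite /w (indic_vball_out (lexx _) yM) mulr0.
- apply: filterS na => y ny.
  have [yB|yB] := pselect (vball x t y); last first.
    rewrite /w indicE (memNset yB) mulr0.
    by under eq_fun do rewrite mulr0; exact: cvg_cst.
  apply: cvgM; last exact: cvg_cst.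
  have -> : \1_[set y : space R | lin v y < a] y = (lin u y - c < 2^-1)%R%:R :> R.
    rewrite indicE; congr (nat_of_bool _)%:R; rewrite linE.
    rewrite -{2}(addr0 2^-1) ltrD2l pmulr_rlt0 // subr_lt0.
    by apply/idP/idP; rewrite inE.
  apply: step_poly_cvg; first by apply: s01; exact: vball_box yB.
  rewrite linE -{2}(addr0 2^-1) (inj_eq (addrI _)) mulf_eq0 gt_eqF //=.
  by rewrite subr_eq0.
- move=> n.
  have [_ gn] := @ball_null_step_poly R Gamma T c h u n (2 ^ n) oG gh.
  rewrite -[RHS](gn x t Gx t0 tT); apply: eq_Rintegral => y _.
  by rewrite /w mulrA.
Qed.

Lemma ball_null_quadrant (R : realType) (Gamma : set (R * R)) (T a b : R)
    (h : R * R * R -> R) : open Gamma -> ball_null Gamma T h ->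
  ball_null Gamma T (fun y => h y * \1_[set y : space R | y.1.1 < a] y *
                             \1_[set y : space R | y.1.2 < b] y).
Proof.
move=> oG gh.
have l10 y : lin (1, 0) y = y.1.1 :> R by rewrite /lin /= mul1r mul0r addr0.
have l01 y : lin (0, 1) y = y.1.2 :> R by rewrite /lin /= mul1r mul0r add0r.
have n0 : {ae vol R, forall y, lin (1, 0) y != a}.
  by apply: filterS (vol_null_coord0 a) => y; rewrite l10.
have n1 : {ae vol R, forall y, lin (0, 1) y != b}.
  by apply: filterS (vol_null_coord1 b) => y; rewrite l01.
have := ball_null_halfspace oG n1 (ball_null_halfspace oG n0 gh).
have -> : [set y : space R | lin (1, 0) y < a] = [set y | y.1.1 < a].
  by apply/seteqP; split => y; rewrite /= l10.
have -> // : [set y : space R | lin (0, 1) y < b] = [set y | y.1.2 < b].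
by apply/seteqP; split => y; rewrite /= l01.
Qed.

(** * Even functions are determined by their integrals over balls *)

(** In the coordinates S y = (y1, y2, rho x y) the value |y.2| is recovered as a
square root, so an even h is, almost everywhere, a function of S y. *)
Lemma ball_null_ae_eq0 (R : realType) (Gamma : set (R * R)) (T : R)
    (h : R * R * R -> R) (x : R * R) (t : R) :
  open Gamma -> ball_null Gamma T h -> {ae vol R, forall y, h (reflection y) = h y} ->
  Gamma x -> t < T -> {ae vol R, forall y, rho x y < t -> h y = 0}.
Proof.
move=> oG gh eh Gx tT; have [lh _] := gh; have [mh _] := lh.
have [m0 m1 m2] := measurable_coords R.
have [mr _] := locbd_rho x.
pose S (y : space R) : space R := (y.1, rho x y).
have mS : measurable_fun setT S by apply: measurable_fun_pair => //; exact: measurable_fst.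
pose q (z : space R) := z.2 - (z.1.1 - x.1) ^+ 2 - (z.1.2 - x.2) ^+ 2.
have mq : measurable_fun setT q.
  apply: measurable_funB; first apply: measurable_funB => //.
    by apply: measurable_funX; apply: measurable_funB => //; exact: measurable_cst.
  by apply: measurable_funX; apply: measurable_funB => //; exact: measurable_cst.
(* G recovers (y1, y2, |y3|) from S y *)
pose G (z : space R) : space R := (z.1, Num.sqrt (q z)).
have mG : measurable_fun setT G.
  apply: measurable_fun_pair; first exact: measurable_fst.
  have ms : measurable_fun setT (@Num.sqrt R).
    by apply: continuous_measurable_fun; exact: sqrt_continuous.
  exact: (measurableT_comp ms mq).
have GS y : G (S y) = (y.1, `|y.2|).
  rewrite /G /S /q /=; congr (_, _); rewrite -sqrtr_sqr; congr Num.sqrt.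
  by rewrite /rho; ring.
have hg : {ae vol R, forall y, h y = (h \o G) (S y)}.
  apply: filterS eh => y ey; rewrite /= GS.
  have [y0|y0] := leP 0 y.2; first by rewrite ger0_norm //; case: (y).
  by rewrite ltr0_norm // -[LHS]ey.
have := @ae_eq0_dynkin R h (\1_(vball x t)) (h \o G) S lh (locbd_vball x t)
  (bsupp_vball x t) _ mS (measurableT_comp mh mG) hg.
have w0 y : 0 <= \1_(vball x t) y :> R by rewrite indicE.
move=> /(_ w0) H; apply: filterS (H _) => [y + yt|a b c].
  by rewrite indicE mem_set // mulr1.
have [_ gq] := ball_null_quadrant a b oG gh.
(* on the ball rho < t, the condition rho < c means rho < min c t *)
pose m := Num.min c t.
have [m_gt0|m_le0] := ltP 0 m.
  have mT : m < T by rewrite (le_lt_trans _ tT) // /m ge_min lexx orbT.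
  rewrite -[RHS](gq x m Gx m_gt0 mT); apply: eq_Rintegral => y _.
  rewrite -!mulrA; congr (_ * _); rewrite !indicE -!natrM !mulnb; congr (nat_of_bool _)%:R.
  rewrite -!in_setI; apply/idP/idP; rewrite !inE /vball /orthant /S /= /m lt_min.
    by move=> [? [? ? ->]]; do 2 split=> //.
  by move=> [? [? /andP[? ?]]].
rewrite (_ : (fun y => _) = cst 0); first by rewrite Rintegral_cst // mul0r.
apply/funext => y; rewrite !indicE -natrM mulnb -in_setI memNset ?mulr0 //.
rewrite /vball /orthant /S /= => -[h1 [_ _ h2]].
have := rho_ge0 x y; move: m_le0; rewrite leNgt /m lt_min => /negP h3 h4.
by apply: h3; rewrite (le_lt_trans h4 h1) (le_lt_trans h4 h2).
Qed.

Lemma eball_rho (R : realType) (x : R * R) (r : R) y :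
  0 < r -> eball x r y <-> rho x y < r ^+ 2.
Proof.
move=> r0; rewrite /eball /= /enorm.
have -> : \sum_(i < 3) comp3 i (y - (x, 0)) ^+ 2 = rho x y.
  by rewrite !big_ord_recl big_ord0 /comp3 /rho /= subr0 addr0 addrA.
have -> : (Num.sqrt (rho x y) < r) = (rho x y < r ^+ 2); last by [].
rewrite -{1}(ger0_norm (ltW r0)) -sqrtr_sqr ltr_sqrt ?exprn_gt0 //.
Qed.

(** A point of Omega also lies in a ball with rational centre in Gamma and rational
squared radius below Rmax ^ 2. *)
Lemma ball_null_ae_eq0_Omega (R : realType) (Gamma : set (R * R)) (Rmax : R)
    (h : R * R * R -> R) :
  0 < Rmax -> open Gamma -> ball_null Gamma (Rmax ^+ 2) h ->
  {ae vol R, forall y, h (reflection y) = h y} ->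
  {ae vol R, forall y, Omega Gamma Rmax y -> h y = 0}.
Proof.
move=> R0 oG gh eh.
pose P (i : rat * rat * rat) y := Gamma (ratr i.1.1, ratr i.1.2) ->
  ratr i.2 < Rmax ^+ 2 -> rho (ratr i.1.1, ratr i.1.2) y < ratr i.2 -> h y = 0.
have HP i : {ae vol R, forall y, P i y}.
  have [Gi|nGi] := pselect (Gamma (ratr i.1.1, ratr i.1.2)); last first.
    by apply: aeW => y /nGi.
  have [iT|iT] := boolP (ratr i.2 < Rmax ^+ 2); last first.
    by apply: aeW => y _ /(negP iT).
  by apply: filterS (ball_null_ae_eq0 oG gh eh Gi iT) => y hy _ _.
have : {ae vol R, forall y, forall n, if unpickle n is Some i then P i y else True}.
  by apply/ae_foralln => n; case: (unpickle n) => [i|]; [exact: HP|exact: aeW].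
apply: filterS => y Hy [x Gx /(eball_rho _ _ R0) xy].
have [e e0 he] := open_ball2 oG Gx.
(* moving each coordinate of the centre by less than d <= 1 increases the squared
   distance to y by less than d K *)
pose K := 2 * `|y.1.1 - x.1| + 2 * `|y.1.2 - x.2| + 2.
have K0 : 0 < K.
  by rewrite /K; have := normr_ge0 (y.1.1 - x.1); have := normr_ge0 (y.1.2 - x.2); lra.
pose d := Num.min (Num.min e 1) ((Rmax ^+ 2 - rho x y) / K).
have d0 : 0 < d by rewrite /d !lt_min e0 ltr01 /= divr_gt0 // subr_gt0.
have de : d <= e by rewrite /d !ge_min lexx.
have d1 : d <= 1 by rewrite /d !ge_min lexx orbT.
have dK : d * K <= Rmax ^+ 2 - rho x y.
  by rewrite -ler_pdivlMr // /d ge_min lexx orbT.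
have near_x (z c : R) : exists2 q : rat,
    `|z - ratr q| < d & (c - ratr q) ^+ 2 < (c - z) ^+ 2 + 2 * `|c - z| * d + d.
  have [q] : exists q : rat, ratr q \in `]z, (z + d)[ by apply: rat_in_itvoo; rewrite ltrDl.
  rewrite in_itv /= => /andP[qa qb]; exists q.
    by rewrite distrC gtr0_norm ?subr_gt0 //; lra.
  pose s := ratr q - z; have sd : s < d by rewrite /s; lra.
  have s0 : 0 < s by rewrite /s; lra.
  have -> : c - ratr q = (c - z) - s by rewrite /s; ring.
  have h1 : - (c - z) * s <= `|c - z| * d.
    rewrite (@le_trans _ _ (`|c - z| * s)) //; last by rewrite ler_wpM2l // ltW.
    by rewrite ler_wpM2r ?(ltW s0) // -normrN ler_norm.
  have h2 : s * s < d * 1 by rewrite ltr_pM ?(ltW s0) //; lra.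
  rewrite !expr2; nra.
have [q1 q1a q1b] := near_x x.1 y.1.1.
have [q2 q2a q2b] := near_x x.2 y.1.2.
have Gq : Gamma (ratr q1, ratr q2).
  by apply: he => /=; [exact: lt_le_trans q1a de|exact: lt_le_trans q2a de].
have qy : rho (ratr q1, ratr q2) y < Rmax ^+ 2.
  by move: dK; rewrite /K {1}/rho /= => dK; rewrite /rho /=; nra.
have [q3] := rat_in_itvoo qy; rewrite in_itv /= => /andP[q3a q3b].
have := Hy (pickle (q1, q2, q3)); rewrite pickleK; exact.
Qed.

(** * From almost every ball to every ball *)

(** Property Q cannot fail on a whole box, which has positive measure. *)
Lemma ae_dense (R : realType) (Q : R * R * R -> Prop) (c : R * R * R) (d : R) :
  {ae vol R, forall p, Q p} -> 0 < d ->
  exists p, [/\ `|p.1.1 - c.1.1| < d, `|p.1.2 - c.1.2| < d,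
                `|p.2 - c.2| < d & Q p].
Proof.
move=> [N [mN N0 QN]] d0; apply: contrapT => nex.
pose I (z : R) : set R := `]z - d, z + d[%classic.
have mI z : measurable (I z) by exact: measurable_itv.
have lI z : @lebesgue_measure R (I z) = (d + d)%:E.
  rewrite /I lebesgue_measure_itv /= lte_fin ifT; last by lra.
  by rewrite -EFinB; congr (_%:E); ring.
have mB2 := measurableX (mI c.1.1) (mI c.1.2).
have e2 := product_measure1E (@lebesgue_measure R) (@lebesgue_measure R)
  (mI c.1.1) (mI c.1.2).
have e3 := product_measure1E (@lebesgue_measure R \x @lebesgue_measure R)%E
  (@lebesgue_measure R) mB2 (mI c.2).
have sub : (I c.1.1 `*` I c.1.2) `*` I c.2 `<=` N.
  move=> p [[/= p0 p1] p2]; apply: QN => /= Qp; apply: nex; exists p.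
  move: p0 p1 p2; rewrite /I /= !in_itv /= => /andP[a0 b0] /andP[a1 b1] /andP[a2 b2].
  by split=> //; rewrite ltr_norml; apply/andP; split; lra.
have : (vol R ((I c.1.1 `*` I c.1.2) `*` I c.2) <= vol R N)%E.
  apply: (@le_measure _ _ _ (vol R)) => //; rewrite inE //.
  exact: (measurableX mB2 (mI c.2)).
rewrite N0 leNgt => /negP; apply; rewrite (_ : vol R _ = ((d + d) * (d + d) * (d + d))%:E).
  by rewrite lte_fin !mulr_gt0 // addr_gt0.
apply: etrans e3 _; have := e2 => /= ->.
have fin (a b b' : \bar R) : a = (d + d)%:E -> b = (d + d)%:E ->
    b' = (d + d)%:E -> (a * b * b')%E = ((d + d) * (d + d) * (d + d))%:E.
  by move=> -> -> ->; rewrite -!EFinM.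
exact: fin (lI _) (lI _) (lI _).
Qed.

(** Given a ball, choose balls with vanishing integral whose centres and
radii converge to its own.  Their indicators converge off the limiting sphere. *)
Lemma ball_null_of_ae (R : realType) (Gamma : set (R * R)) (Rmax : R)
    (f : R * R * R -> R) :
  open Gamma -> 0 < Rmax -> locint f ->
  {ae vol R, forall p, Gamma p.1 -> 0 < p.2 -> p.2 < Rmax ->
    \int[vol R]_y (f y * \1_(vball p.1 (p.2 ^+ 2)) y) = 0} ->
  ball_null Gamma (Rmax ^+ 2) f.
Proof.
move=> oG R0 lf ae0; split => // x t Gx t0 tT.
have [e e0 he] := open_ball2 oG Gx.
pose r := Num.sqrt t.
have r0 : 0 < r by rewrite sqrtr_gt0.
have rr : r ^+ 2 = t by rewrite sqr_sqrtr // ltW.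
have rR : r < Rmax by rewrite -(ltr_pXn2r (_ : (0 < 2)%N)) ?nnegrE ?(ltW r0) ?(ltW R0) // rr.
(* perturbing x and r by less than d keeps the centre in Gamma and the radius
   in ]0, Rmax[ *)
pose d := Num.min (Num.min e 1) (Num.min r (Rmax - r)).
have d0 : 0 < d by rewrite /d !lt_min e0 ltr01 r0 subr_gt0.
have de : d <= e by rewrite /d !ge_min lexx.
have d1 : d <= 1 by rewrite /d !ge_min lexx orbT.
have dr : d <= r by rewrite /d !ge_min lexx !orbT.
have dR : d <= Rmax - r by rewrite /d !ge_min lexx !orbT.
have har0 n : 0 < harmonic n :> R by rewrite /harmonic /= invr_gt0.
have har1 n : harmonic n <= 1 :> R by rewrite /harmonic /= invf_le1 // ler1n.
have dh0 n : 0 < d * harmonic n by rewrite mulr_gt0.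
have dh n : d * harmonic n <= d by rewrite ler_piMr // ltW.
have /choice [p Hp] : forall n, exists p : R * R * R,
    [/\ `|p.1.1 - x.1| < d * harmonic n, `|p.1.2 - x.2| < d * harmonic n,
        `|p.2 - r| < d * harmonic n &
        \int[vol R]_y (f y * \1_(vball p.1 (p.2 ^+ 2)) y) = 0].
  move=> n; have [p [p0 p1 p2 Qp]] := ae_dense (x, r) ae0 (dh0 n).
  exists p; split => //=; apply: Qp.
  - apply: he; rewrite distrC; apply: lt_le_trans de; apply: lt_le_trans (dh n).
      exact: p0.
    exact: p1.
  - have := lt_le_trans p2 (dh n); rewrite ltr_norml => /andP[/= p2a p2b]; lra.
  - have := lt_le_trans p2 (dh n); rewrite ltr_norml => /andP[/= p2a p2b]; lra.
have dh_0 : d * harmonic n @[n --> \oo] --> (0 : R).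
  by rewrite -(mulr0 d); apply: cvgM; [exact: cvg_cst|exact: cvg_harmonic].
have tends (u : nat -> R) (l : R) : (forall n, `|u n - l| < d * harmonic n) ->
    u n @[n --> \oo] --> l.
  move=> ul; apply/cvgrPdist_le => eps eps0.
  move/cvgr0_norm_le : dh_0 => /(_ _ eps0); apply: filterS => n.
  rewrite gtr0_norm // distrC => /(lt_le_trans (ul n)) /ltW //.
have c1 : (p n).1.1 @[n --> \oo] --> x.1 by apply: tends => n; have [] := Hp n.
have c2 : (p n).1.2 @[n --> \oo] --> x.2 by apply: tends => n; have [] := Hp n.
have c3 : (p n).2 @[n --> \oo] --> r by apply: tends => n; have [] := Hp n.
pose M := (`|x.1| + 1) + (`|x.2| + 1) + 1 + (r + 1) ^+ 2.
have MM n : `|(p n).1.1| + `|(p n).1.2| + 1 + (p n).2 ^+ 2 <= M.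
  have [p0 p1 p2 _] := Hp n; have hd := le_trans (dh n) d1.
  have b0 : `|(p n).1.1| <= `|x.1| + 1.
    rewrite -[(p n).1.1](subrK x.1) (le_trans (ler_normD _ _)) // addrC lerD2l.
    by rewrite (le_trans (ltW p0)).
  have b1 : `|(p n).1.2| <= `|x.2| + 1.
    rewrite -[(p n).1.2](subrK x.2) (le_trans (ler_normD _ _)) // addrC lerD2l.
    by rewrite (le_trans (ltW p1)).
  have b2 : (p n).2 ^+ 2 <= (r + 1) ^+ 2.
    have := lt_le_trans p2 (dh n); rewrite ltr_norml => /andP[p2a p2b].
    by rewrite ler_pXn2r ?nnegrE //; lra.
  by rewrite /M; lra.
apply: (@pair_cvg_eq0 R f lf _ (fun n => \1_(vball (p n).1 ((p n).2 ^+ 2))) 1 M).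
- by move=> n; exact: locbd_vball.
- by have [] := locbd_vball x t.
- by move=> n y _; rewrite ger0_norm ?indic_le1 // indicE.
- by move=> n y; exact: indic_vball_out.
- apply: filterS (sphere_null x t) => y ny.
  have lim : (p n).2 ^+ 2 - rho (p n).1 y @[n --> \oo] --> t - rho x y.
    rewrite -rr /rho; apply: cvgB; first by rewrite !expr2; exact: cvgM.
    apply: cvgD; last exact: cvg_cst.
    have sq (u : nat -> R) (a l : R) : u n @[n --> \oo] --> l ->
        (a - u n) ^+ 2 @[n --> \oo] --> (a - l) ^+ 2.
      move=> ul; have ul' : a - u n @[n --> \oo] --> a - l.
        by apply: cvgB => //; exact: cvg_cst.
      by rewrite expr2; under eq_fun do rewrite expr2; exact: cvgM.
    by apply: cvgD; exact: sq.
  have [yin|yout] := ltP (rho x y) t.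
    rewrite [X in _ --> X]indicE mem_set //; apply: cvg_near_cst.
    have : 0 < t - rho x y by rewrite subr_gt0.
    move/(cvgr_gt _ lim); apply: filterS => n hn.
    by rewrite indicE mem_set // /vball /= -subr_gt0.
  have {}yout : t < rho x y by rewrite lt_neqAle eq_sym ny.
  rewrite [X in _ --> X]indicE memNset; last first.
    by rewrite /vball /=; apply/negP; rewrite -leNgt ltW.
  apply: cvg_near_cst.
  have : t - rho x y < 0 by rewrite subr_lt0.
  move/(cvgr_lt _ lim); apply: filterS => n hn.
  rewrite indicE memNset // /vball /=; apply/negP; rewrite -leNgt -subr_le0.
  exact: ltW.
- by move=> n; have [] := Hp n.
Qed.

Lemma Rintegral_eball (R : realType) (f : R * R * R -> R) (x : R * R) (r : R) :
  0 < r -> \int[leb3 R]_(y in eball x r) f y =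
           \int[vol R]_y (f y * \1_(vball x (r ^+ 2)) y).
Proof.
move=> r0; have -> : eball x r = vball x (r ^+ 2).
  by apply/seteqP; split => y /(eball_rho _ _ r0).
rewrite Rintegral_mkcond; apply: eq_Rintegral => y _.
by rewrite patchE indicE; case: ifPn => _; rewrite ?mulr1 ?mulr0.
Qed.

(** * Smooth functions of one variable *)

(** Differentiability of order n with continuous derivatives, phrased so that the
closure properties follow by induction on n. *)
Fixpoint smooth1 (R : realType) (n : nat) (a : R -> R) : Prop :=
  continuous a /\
  if n is m.+1 then
    exists a' : R -> R, (forall x, is_derive x (1 : R) a (a' x)) /\ smooth1 m a'
  else True.

Lemma smooth1_continuous (R : realType) n (a : R -> R) :
  smooth1 n a -> continuous a.
Proof. by case: n => [|n] []. Qed.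

Lemma smooth1W (R : realType) n (a : R -> R) : smooth1 n.+1 a -> smooth1 n a.
Proof.
elim: n a => [|n IH] a; first by move=> [].
by move=> [ca [a' [da sa']]]; split => //; exists a'; split => //; exact: IH.
Qed.

Lemma smooth1_lin (R : realType) n (a b : R -> R) (c d : R) :
  smooth1 n a -> smooth1 n b -> smooth1 n (fun x => c * a x + d * b x).
Proof.
have cont (u v : R -> R) : continuous u -> continuous v ->
    continuous (fun x => c * u x + d * v x).
  by move=> cu cv x; apply: cvgD; apply: cvgM; [exact: cvg_cst|exact: cu|exact: cvg_cst|exact: cv].
elim: n a b => [|n IH] a b.
  by move=> [ca _] [cb _]; split => //; exact: cont.
move=> [ca [a' [da sa]]] [cb [b' [db sb]]]; split; first exact: cont.
exists (fun x => c * a' x + d * b' x); split; last exact: IH.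
move=> x; have dax := da x; have dbx := db x.
exact: (is_deriveD (is_deriveZ c dax) (is_deriveZ d dbx)).
Qed.

Lemma smooth1M (R : realType) n (a b : R -> R) :
  smooth1 n a -> smooth1 n b -> smooth1 n (fun x => a x * b x).
Proof.
have cont (u v : R -> R) : continuous u -> continuous v ->
    continuous (fun x => u x * v x).
  by move=> cu cv x; apply: cvgM; [exact: cu|exact: cv].
elim: n a b => [|n IH] a b.
  by move=> [ca _] [cb _]; split => //; exact: cont.
move=> sa sb; have sa0 := smooth1W sa; have sb0 := smooth1W sb.
have [ca [a' [da sa']]] := sa; have [cb [b' [db sb']]] := sb.
split; first exact: cont.
exists (fun x => 1 * (a x * b' x) + 1 * (b x * a' x)); split; last first.
  by apply: smooth1_lin; exact: IH.
move=> x; have dax := da x; have dbx := db x.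
apply: is_derive_eq (is_deriveM dax dbx) _.
by rewrite !mul1r.
Qed.

Lemma smooth1_affine (R : realType) n (a : R -> R) (k l : R) :
  smooth1 n a -> smooth1 n (fun x => a (k * x + l)).
Proof.
have cont (u : R -> R) : continuous u -> continuous (fun x => u (k * x + l)).
  move=> cu x; apply: (@continuous_comp _ _ _ (fun x => k * x + l) u); last exact: cu.
  by apply: cvgD; [apply: cvgM; [exact: cvg_cst|exact: cvg_id]|exact: cvg_cst].
elim: n a => [|n IH] a; first by move=> [ca _]; split => //; exact: cont.
move=> [ca [a' [da sa]]]; split; first exact: cont.
exists (fun x => k * a' (k * x + l) + 0 * a' (k * x + l)); split; last first.
  by apply: smooth1_lin; exact: IH.
move=> x; have da1 := da (k * x + l).
have dl : is_derive x (1 : R) (fun x => k * x + l) k.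
  apply: is_derive_eq (is_deriveD (is_deriveZ k (is_derive_id x (1 : R))) (is_derive_cst l x 1)) _.
  by rewrite addr0 /GRing.scale /= mulr1.
apply: is_derive_eq (@is_derive1_comp _ a (fun x => k * x + l) x _ _ da1 dl) _.
by rewrite mul0r addr0 mulrC.
Qed.

(** A family closed under differentiation up to linear combinations, which is why
the powers of 1/x are included; [flat 0] is the function exp (-1/x), extended by 0. *)
Definition flat (R : realType) (m : nat) (x : R) : R :=
  if 0 < x then x^-1 ^+ m * expR (- x^-1) else 0.

(** With w = 1/x this is exp w >= w ^ (m + 1) / (m + 1)!; it gives continuity
at 0 for all m at once. *)
Lemma flat_bound (R : realType) (m : nat) (x : R) :
  `|flat m x| <= (m.+1)`!%:R * `|x|.
Proof.
rewrite /flat; case: ifPn => [x0|_]; last by rewrite normr0 mulr_ge0.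
have w0 : 0 < x^-1 by rewrite invr_gt0.
rewrite !ger0_norm ?(ltW x0) //; last first.
  by rewrite mulr_ge0 ?exprn_ge0 ?expR_ge0 // ltW.
rewrite expRN -ler_pdivlMr ?invr_gt0 ?expR_gt0 // invrK.
have := expR_ge1Dxn m (ltW w0); set e := expR _; rewrite exprS => h.
have f0 : 0 < (m.+1)`!%:R :> R by rewrite ltr0n fact_gt0.
have {}h : x^-1 * x^-1 ^+ m <= e * (m.+1)`!%:R.
  by rewrite -ler_pdivrMr // (le_trans _ h) // lerDr.
by move: h; rewrite mulrC ler_pdivrMr // => h; rewrite mulrAC [_ * e]mulrC.
Qed.

Lemma flat_gt0E (R : realType) (m : nat) (x : R) : 0 < x ->
  flat m x = x^-1 ^+ m * expR (- x^-1).
Proof. by rewrite /flat => ->. Qed.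

Lemma flat_le0E (R : realType) (m : nat) (x : R) : x <= 0 -> flat m x = 0.
Proof. by rewrite /flat leNgt => /negbTE ->. Qed.

(** At 0 the identity flat m z = flat (m + 1) z * z exhibits the derivative in
Caratheodory's form. *)
Lemma is_derive_flat (R : realType) (m : nat) (x : R) :
  is_derive x (1 : R) (flat m) (1 * flat m.+2 x + (- m%:R) * flat m.+1 x).
Proof.
have [x0|x0|x0] := ltrgtP 0 x.
- pose G (w : R) := w ^+ m * expR (- w).
  have dV : is_derive x (1 : R) (fun z : R => z^-1) (- x ^- 2).
    have xn0 : id x != 0 by rewrite gt_eqF.
    apply: DeriveDef; first by apply: (@derivableV _ _ id).
    by rewrite (@deriveV _ _ id) // derive_id /GRing.scale /= mulr1.
  have dN : is_derive x^-1 (1 : R) (fun w : R => expR (- w)) (expR (- x^-1) * -1).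
    apply: (@is_derive1_comp _ expR (fun w => - w)).
  have dX : is_derive x^-1 (1 : R) (fun w : R => w ^+ m) (m%:R * x^-1 ^+ m.-1).
    have -> : (fun w : R => w ^+ m) = (id : R -> R) ^+ m.
      by apply/funext => w; rewrite exprfctE.
    apply: is_derive_eq (is_deriveX m (is_derive_id x^-1 (1 : R))) _.
    by rewrite /GRing.scale /= mulr1.
  have dG := is_deriveM dX dN.
  have dF := @is_derive1_comp _ G (fun z => z^-1) x _ _ dG dV.
  have near_x : \near x, (G \o (fun z => z^-1)) x = flat m x.
    have : \forall z \near x, 0 < z by exact: lt_nbhsr.
    by apply: filterS => z z0; rewrite flat_gt0E.
  apply: is_derive_eq (near_eq_is_derive near_x dF) _.
  rewrite !flat_gt0E // /GRing.scale /=; set e := expR _.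
  case: m @G dX dG dF near_x => [|m] _ _ _ _ _ /=; rewrite ?expr0 ?exprS; field; by rewrite gt_eqF.
- have near_x : \near x, cst 0 x = flat m x.
    have : \forall z \near x, z < 0 by exact: lt_nbhsl.
    by apply: filterS => z z0; rewrite flat_le0E // ltW.
  apply: is_derive_eq (near_eq_is_derive near_x (is_derive_cst (0 : R) x 1)) _.
  by rewrite !flat_le0E ?ltW // !mulr0 addr0.
- rewrite -x0; apply/is_derive1_caratheodory; exists (flat m.+1); split.
  + move=> z; rewrite (flat_le0E _ (lexx 0)) !subr0.
    have [z0|z0] := ltP 0 z; last by rewrite !flat_le0E // mul0r.
    by rewrite !flat_gt0E // exprS; field; rewrite gt_eqF.
  + rewrite /prop_for /continuous_at (flat_le0E _ (lexx 0)).
    apply/cvgrPdist_le => e e0.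
    pose C : R := (m.+2)`!%:R.
    have C0 : 0 < C by rewrite ltr0n fact_gt0.
    have eC : 0 < e / C by rewrite divr_gt0.
    have : \forall z \near (0 : R), `|0 - z| < e / C by exact: nbhsx_ballx.
    apply: filterS => z; rewrite !sub0r !normrN => hz.
    rewrite (le_trans (flat_bound _ _)) // -/C mulrC -ler_pdivlMr // ltW //.
  + by rewrite !(flat_le0E _ (lexx 0)) !mulr0 addr0.
Qed.

Lemma smooth1_flat (R : realType) n m : smooth1 n (@flat R m).
Proof.
have cf k : continuous (@flat R k).
  move=> x; have [dx _] := is_derive_flat k x.
  by apply: differentiable_continuous; apply/derivable1_diffP.
elim: n m => [|n IH] m; first by split.
split => //; exists (fun x => 1 * flat m.+2 x + (- m%:R) * flat m.+1 x); split.
  by move=> x; exact: is_derive_flat.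
exact: smooth1_lin.
Qed.

(** * Test functions approximating boxes *)

(** A bump supported in [a, b]; as n grows it tends to the indicator of the open
interval, because exp (-1 / (n c)) tends to 1 for c > 0. *)
Definition window (R : realType) (a b : R) (n : nat) (x : R) : R :=
  flat 0 (n.+1%:R * x + - (n.+1%:R * a)) * flat 0 (- n.+1%:R * x + n.+1%:R * b).

Lemma smooth1_window (R : realType) (a b : R) n k : smooth1 k (window a b n).
Proof. by apply: smooth1M; apply: smooth1_affine; exact: smooth1_flat. Qed.

Lemma flat0_01 (R : realType) (x : R) : 0 <= flat 0 x <= 1.
Proof.
rewrite /flat; case: ifPn => [x0|_]; last by rewrite lexx ler01.
by rewrite expr0 mul1r expR_ge0 -expR0 ler_expR oppr_le0 invr_ge0 ltW.
Qed.

Lemma window_ge0 (R : realType) (a b : R) n x : 0 <= window a b n x.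
Proof. have /andP[p0 _] := flat0_01 (n.+1%:R * x + - (n.+1%:R * a)).
have /andP[q0 _] := flat0_01 (- n.+1%:R * x + n.+1%:R * b).
exact: mulr_ge0.
Qed.

Lemma window_le1 (R : realType) (a b : R) n x : window a b n x <= 1.
Proof.
have /andP[p0 p1] := flat0_01 (n.+1%:R * x + - (n.+1%:R * a)).
have /andP[q0 q1] := flat0_01 (- n.+1%:R * x + n.+1%:R * b).
exact: mulr_ile1.
Qed.

Lemma window_out (R : realType) (a b : R) n x :
  ~ `]a, b[%classic x -> window a b n x = 0.
Proof.
rewrite /= in_itv /= => /negP; rewrite negb_and -!leNgt /window => /orP[h|h].
  by rewrite flat_le0E ?mul0r // -mulrBr pmulr_rle0 ?ltr0n // subr_le0.
by rewrite [X in _ * X]flat_le0E ?mulr0 // mulNr addrC -mulrBr pmulr_rle0 ?ltr0n // subr_le0.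
Qed.

Lemma flat0_cvg1 (R : realType) (c : R) : 0 < c ->
  flat 0 (n.+1%:R * c) @[n --> \oo] --> (1 : R).
Proof.
move=> c0.
have E n : flat 0 (n.+1%:R * c) = expR (- (c^-1 * harmonic n)).
  by rewrite flat_gt0E ?mulr_gt0 // expr0 mul1r invfM mulrC.
under eq_fun do rewrite E.
have lim0 : - (c^-1 * harmonic n) @[n --> \oo] --> (0 : R).
  rewrite -oppr0; apply: cvgN; rewrite -(mulr0 c^-1).
  by apply: cvgM; [exact: cvg_cst|exact: cvg_harmonic].
rewrite -expR0; apply: cvg_comp lim0 _; exact: continuous_expR.
Qed.

Lemma window_cvg (R : realType) (a b x : R) :
  window a b n x @[n --> \oo] --> (\1_(`]a, b[%classic) x : R).
Proof.
have [xab|xab] := pselect (`]a, b[%classic x).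
  rewrite indicE mem_set //; move: xab; rewrite /= in_itv /= => /andP[ax xb].
  have E n : window a b n x =
      flat 0 (n.+1%:R * (x - a)) * flat 0 (n.+1%:R * (b - x)).
    by rewrite /window; congr (flat _ _ * flat _ _); ring.
  rewrite -[X in _ --> X]mulr1; under eq_fun do rewrite E.
  by apply: cvgM; apply: flat0_cvg1; rewrite subr_gt0.
rewrite indicE memNset //; under eq_fun do rewrite window_out //.
exact: cvg_cst.
Qed.

Definition tensor (R : realType) (a b c : R -> R) (y : R * R * R) : R :=
  a y.1.1 * b y.1.2 * c y.2.

Lemma continuous_tensor (R : realType) (a b c : R -> R) :
  continuous a -> continuous b -> continuous c -> continuous (tensor a b c).
Proof.
move=> ca cb cc y.
have f2 : fst @ y --> y.1 by exact: cvg_fst.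
have c2 : snd @ y --> y.2 by exact: cvg_snd.
have f11 : fst @ y.1 --> y.1.1 by exact: cvg_fst.
have f12 : snd @ y.1 --> y.1.2 by exact: cvg_snd.
have c11 := cvg_comp _ _ f2 f11; have c12 := cvg_comp _ _ f2 f12.
have a1 := cvg_comp _ _ c11 (ca y.1.1); have b1 := cvg_comp _ _ c12 (cb y.1.2).
exact: cvgM (cvgM a1 b1) (cvg_comp _ _ c2 (cc y.2)).
Qed.

(** A partial derivative of a product of functions of separate variables only sees
one factor. *)
Lemma is_derive_line (R : realType) (phi : R * R * R -> R) (e y : R * R * R)
    (a : R -> R) (z c d : R) :
  (forall t : R, phi (t *: e + y) = a (t + z) * c) ->
  is_derive z (1 : R) a d -> is_derive y e phi (d * c).
Proof.
move=> line [da <-].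
have E : (fun t : R => t^-1 *: ((phi \o shift y) (t *: e) - phi y)) =
    (fun t : R => (t^-1 *: ((a \o shift z) (t *: 1) - a z)) * c).
  apply/funext => t /=; rewrite line.
  have := line 0; rewrite scale0r !add0r => ->.
  rewrite /GRing.scale /= mulr1; ring.
have cv : (fun t : R => t^-1 *: ((phi \o shift y) (t *: e) - phi y)) @ 0^' -->
    'D_1 a z * c.
  by rewrite E; apply: cvgM; [exact: da|exact: cvg_cst].
split; first by apply/cvg_ex; exists ('D_1 a z * c).
exact: (cvg_lim (@norm_hausdorff _ _) cv).
Qed.

(** The partial derivatives of a product of functions of separate variables are
again such products, which makes [is_Ck] provable by induction. *)
Lemma is_derive_tensor (R : realType) (a b c a' b' c' : R -> R) y :
  (forall x, is_derive x (1 : R) a (a' x)) ->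
  (forall x, is_derive x (1 : R) b (b' x)) ->
  (forall x, is_derive x (1 : R) c (c' x)) -> forall i : 'I_3,
  is_derive y (basis3 R i) (tensor a b c)
    (match val i with
     | 0%N => tensor a' b c y | 1%N => tensor a b' c y | _ => tensor a b c' y
     end).
Proof.
move=> da db dc [[|[|[|//]]] Hi] /=.
- apply: is_derive_eq (@is_derive_line R (tensor a b c) _ y a y.1.1
    (b y.1.2 * c y.2) _ _ (da y.1.1)) _; last by rewrite mulrA.
  move=> t; rewrite /tensor /basis3 /= /GRing.scale /=.
  by rewrite !mulr0 !add0r mulr1 mulrA.
- apply: is_derive_eq (@is_derive_line R (tensor a b c) _ y b y.1.2
    (a y.1.1 * c y.2) _ _ (db y.1.2)) _; last by rewrite /tensor; ring.
  move=> t; rewrite /tensor /basis3 /= /GRing.scale /=.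
  by rewrite !mulr0 !add0r mulr1; ring.
- apply: is_derive_eq (@is_derive_line R (tensor a b c) _ y c y.2
    (a y.1.1 * b y.1.2) _ _ (dc y.2)) _; last by rewrite /tensor; ring.
  move=> t; rewrite /tensor /basis3 /= /GRing.scale /=.
  by rewrite !mulr0 !add0r mulr1; ring.
Qed.

Lemma is_Ck_tensor (R : realType) k (a b c : R -> R) :
  smooth1 k a -> smooth1 k b -> smooth1 k c -> is_Ck k (tensor a b c).
Proof.
elim: k a b c => [|k IH] a b c sa sb sc.
  split => //; apply: continuous_tensor;
  [exact: smooth1_continuous sa|exact: smooth1_continuous sb|exact: smooth1_continuous sc].
have sa0 := smooth1W sa; have sb0 := smooth1W sb; have sc0 := smooth1W sc.
split; first by apply: continuous_tensor;
  [exact: smooth1_continuous sa|exact: smooth1_continuous sb|exact: smooth1_continuous sc].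
have [_ [a' [da sa']]] := sa; have [_ [b' [db sb']]] := sb.
have [_ [c' [dc sc']]] := sc.
move=> i; have dt y := is_derive_tensor y da db dc i.
split; first by move=> y; have [] := dt y.
have -> : (fun y => 'D_(basis3 R i) (tensor a b c) y) =
   (fun y => match val i with
     | 0%N => tensor a' b c y | 1%N => tensor a b' c y | _ => tensor a b c' y
     end) by apply/funext => y; have [] := dt y.
by case: i {dt} => [[|[|[|//]]] Hi] /=; exact: IH.
Qed.

Lemma compact_box (R : realType) (M : R) : compact (box M).
Proof.
rewrite boxE; apply: compact_setX; last exact: segment_compact.
by apply: compact_setX; exact: segment_compact.
Qed.

Lemma test_function_tensor (R : realType) (M : R) (a b c : R -> R) :
  (forall k, smooth1 k a) -> (forall k, smooth1 k b) -> (forall k, smooth1 k c) ->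
  (forall x, M < `|x| -> a x = 0) -> (forall x, M < `|x| -> b x = 0) ->
  (forall x, M < `|x| -> c x = 0) -> test_function (tensor a b c).
Proof.
move=> sa sb sc a0 b0 c0; split; first by move=> k; exact: is_Ck_tensor.
apply: (subclosed_compact _ (@compact_box R M)); first exact: closed_closure.
have cb : closed (box M).
  by apply: compact_closed; [exact: norm_hausdorff|exact: compact_box].
rewrite (closure_id (box M)).1 //; apply: closure_subset => y /eqP y0.
split; rewrite leNgt; apply/negP => h; apply: y0; rewrite /tensor.
- by rewrite a0 ?mul0r.
- by rewrite b0 ?mulr0 ?mul0r.
- by rewrite c0 ?mulr0.
Qed.

(** * Test functions separate locally integrable functions *)

(** Every open set is a countable union of cubes with rational centre and size. *)
Lemma open_measurable3 (R : realType) (O : set (R * R * R)) :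
  open O -> measurable (O : set (space R)).
Proof.
move=> oO.
pose cube (q : R * R * R) (e : R) : set (space R) :=
  [set y | [/\ `|y.1.1 - q.1.1| < e, `|y.1.2 - q.1.2| < e & `|y.2 - q.2| < e]].
have [m0 m1 m2] := measurable_coords R.
have mcube q e : measurable (cube q e).
  have mm (u : space R -> R) (c : R) : measurable_fun setT u ->
      measurable [set y | `|u y - c| < e].
    move=> mu; apply: measurable_lt_set; apply: measurableT_comp => //.
    by apply: measurable_funB => //; exact: measurable_cst.
  have -> : cube q e = [set y : space R | `|y.1.1 - q.1.1| < e] `&`
      ([set y | `|y.1.2 - q.1.2| < e] `&` [set y | `|y.2 - q.2| < e]).
    by apply/seteqP; split => y; [move=> []|move=> [? []]].
  by apply: measurableI; [exact: mm|apply: measurableI; exact: mm].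
pose F (i : rat * rat * rat * rat) : set (space R) :=
  let C := cube (ratr i.1.1.1, ratr i.1.1.2, ratr i.1.2) (ratr i.2) in
  if `[< C `<=` O >] then C else set0.
have mF i : measurable (F i) by rewrite /F; case: ifP.
have -> : O = \bigcup_n (if unpickle n is Some i then F i else set0).
  apply/seteqP; split => [y Oy|y [n _]]; last first.
    case: (unpickle n) => // i; rewrite /F; case: ifPn => // /asboolP; exact.
  have /nbhs_ballP [e /= e0 he] := open_nbhs_nbhs (conj oO Oy).
  have e20 : 0 < e / 2 by rewrite divr_gt0.
  have [r] := rat_in_itvoo e20; rewrite in_itv /= => /andP[r0 re].
  have near_q (z : R) : exists q : rat, `|z - ratr q| < ratr r.
    have zr : z < z + ratr r by rewrite ltrDl.
    have [q] := rat_in_itvoo zr; rewrite in_itv /= => /andP[qa qb].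
    exists q; rewrite distrC gtr0_norm ?subr_gt0 //; lra.
  have [q1 h1] := near_q y.1.1; have [q2 h2] := near_q y.1.2.
  have [q3 h3] := near_q y.2.
  exists (pickle (q1, q2, q3, r)); first exact: I.
  rewrite pickleK /F /= ifT; first by split.
  apply/asboolP => z [/= z1 z2 z3]; apply: he.
  have tri (a b c : R) : `|a - c| < ratr r -> `|b - c| < ratr r -> `|a - b| < e.
    move=> ac bc; rewrite (_ : a - b = (a - c) - (b - c)); last by ring.
    by rewrite (le_lt_trans (ler_normB _ _)) //; lra.
  by split; [split|]; [exact: tri h1 z1|exact: tri h2 z2|exact: tri h3 z3].
by apply: bigcupT_measurable => n; case: (unpickle n).
Qed.

Lemma continuous_locbd (R : realType) (phi : R * R * R -> R) :
  continuous phi -> locbd phi.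
Proof.
move=> cphi; split.
  apply: (measurability _ (RGenInftyO.measurableE R)) => _ [_ [x ->]] <-.
  rewrite setTI; apply: open_measurable3.
  by apply: open_comp => [y _|]; [exact: cphi|exact: interval_open].
move=> M.
have := continuous_compact (continuous_subspaceT cphi) (@compact_box R M).
move=> /compact_bounded [C [_ hC]]; exists (C + 1) => y yM.
by apply: (hC (C + 1)); [rewrite ltrDl|exists y].
Qed.

(** Outside the closed support the function vanishes near each point, hence so do
its derivatives. *)
Lemma test_function_locbd (R : realType) (phi : R * R * R -> R) (i : 'I_3) :
  test_function phi -> [/\ locbd phi, bsupp phi,
    locbd (fun y => 'D_(basis3 R i) phi y) &
    bsupp (fun y => 'D_(basis3 R i) phi y)].
Proof.
move=> [Ck /compact_bounded [M [_ hM]]].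
have [cphi /(_ i) [_ [cD _]]] := Ck 1%N.
have out y : ~ box (M + 1) y -> ~ closure [set x | phi x != 0] y.
  move=> yM yc; apply: yM.
  have := hM (M + 1) (_ : M < M + 1) y yc; rewrite ltrDl => /(_ ltr01).
  rewrite /Num.norm /= /Num.norm /= !ge_max => /andP[/andP[y0 y1] y2].
  by split.
have near0 y : ~ box (M + 1) y -> \forall z \near y, cst 0 z = phi z.
  move=> /out; rewrite -[closure _]setCK => /contrapT.
  rewrite -interiorC /= => hi; apply: filterS hi => z /=.
  by move=> /negP; rewrite negbK => /eqP.
split.
- exact: continuous_locbd.
- by exists (M + 1) => y /near0 /nbhs_singleton.
- exact: continuous_locbd.
- by exists (M + 1) => y /near0 /near_eq_derive <-; rewrite derive_cst.
Qed.

Definition open_box (R : realType) (a b : R * R * R) : set (space R) :=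
  (`]a.1.1, b.1.1[%classic `*` `]a.1.2, b.1.2[%classic) `*` `]a.2, b.2[%classic.

Definition window3 (R : realType) (a b : R * R * R) (n : nat) : R * R * R -> R :=
  tensor (window a.1.1 b.1.1 n) (window a.1.2 b.1.2 n) (window a.2 b.2 n).

Lemma measurable_open_box (R : realType) (a b : R * R * R) :
  measurable (open_box a b).
Proof.
apply: measurableX; last exact: measurable_itv.
by apply: measurableX; exact: measurable_itv.
Qed.

Lemma itv_norm_le (R : realDomainType) (a b x : R) :
  `]a, b[%classic x -> `|x| <= `|a| + `|b|.
Proof.
rewrite /= in_itv /= => /andP[ax xb].
have := ler_norm b; have := ler_norm (- a); rewrite normrN.
have := normr_ge0 a; have := normr_ge0 b.
by move=> a0 b0 na nb; rewrite ler_norml; apply/andP; split; lra.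
Qed.

Definition radius3 (R : realType) (a b : R * R * R) : R :=
  (`|a.1.1| + `|b.1.1|) + (`|a.1.2| + `|b.1.2|) + (`|a.2| + `|b.2|).

Lemma radius3_ge (R : realType) (a b : R * R * R) :
  [/\ `|a.1.1| + `|b.1.1| <= radius3 a b, `|a.1.2| + `|b.1.2| <= radius3 a b &
      `|a.2| + `|b.2| <= radius3 a b].
Proof.
have A (x y : R) : 0 <= `|x| + `|y| by rewrite addr_ge0.
have := A a.1.1 b.1.1; have := A a.1.2 b.1.2; have := A a.2 b.2.
by rewrite /radius3; split; lra.
Qed.

Lemma open_box_sub (R : realType) (a b : R * R * R) :
  open_box a b `<=` box (radius3 a b).
Proof.
have [r0 r1 r2] := radius3_ge a b.
move=> y [[/itv_norm_le h0 /itv_norm_le h1] /itv_norm_le h2].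
by split; [exact: le_trans r0|exact: le_trans r1|exact: le_trans r2].
Qed.

Lemma window3_cvg (R : realType) (a b y : R * R * R) :
  window3 a b n y @[n --> \oo] --> (\1_(open_box a b) y : R).
Proof.
have -> : \1_(open_box a b) y = \1_(`]a.1.1, b.1.1[%classic) y.1.1 *
    \1_(`]a.1.2, b.1.2[%classic) y.1.2 * \1_(`]a.2, b.2[%classic) y.2 :> R.
  rewrite !indicE -!natrM !mulnb; congr (nat_of_bool _)%:R.
  apply/idP/idP; rewrite inE.
    by move=> [[/= h0 h1] h2]; rewrite !mem_set.
  by move=> /andP[/andP[]]; rewrite !inE.
by apply: cvgM; [apply: cvgM|]; exact: window_cvg.
Qed.

Lemma window3_01 (R : realType) (a b : R * R * R) n y : 0 <= window3 a b n y <= 1.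
Proof.
rewrite /window3 /tensor.
have w0 := window_ge0 a.1.1 b.1.1 n y.1.1; have w0' := window_le1 a.1.1 b.1.1 n y.1.1.
have w1 := window_ge0 a.1.2 b.1.2 n y.1.2; have w1' := window_le1 a.1.2 b.1.2 n y.1.2.
have w2 := window_ge0 a.2 b.2 n y.2; have w2' := window_le1 a.2 b.2 n y.2.
apply/andP; split; first by apply: mulr_ge0 => //; exact: mulr_ge0.
by apply: mulr_ile1 => //; [exact: mulr_ge0|exact: mulr_ile1].
Qed.

Lemma test_function_window3 (R : realType) (a b : R * R * R) n :
  test_function (window3 a b n).
Proof.
have [r0 r1 r2] := radius3_ge a b.
have out (c d : R) : `|c| + `|d| <= radius3 a b -> forall x,
    radius3 a b < `|x| -> window c d n x = 0.
  move=> cd x rx; apply: window_out => /itv_norm_le.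
  by rewrite leNgt (le_lt_trans cd).
apply: (@test_function_tensor R (radius3 a b)).
- by move=> k; exact: smooth1_window.
- by move=> k; exact: smooth1_window.
- by move=> k; exact: smooth1_window.
- exact: out.
- exact: out.
- exact: out.
Qed.

Lemma window3_out (R : realType) (a b : R * R * R) n y :
  ~ box (radius3 a b) y -> window3 a b n y = 0.
Proof.
move=> yb; have nb : ~ open_box a b y by move=> /open_box_sub.
have [h0|h0] := pselect (`]a.1.1, b.1.1[%classic y.1.1); last first.
  by rewrite /window3 /tensor window_out ?mul0r.
have [h1|h1] := pselect (`]a.1.2, b.1.2[%classic y.1.2); last first.
  by rewrite /window3 /tensor (window_out _ h1) ?mulr0 ?mul0r.
have [h2|h2] := pselect (`]a.2, b.2[%classic y.2); last first.
  by rewrite /window3 /tensor (window_out _ h2) ?mulr0.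
by exfalso; apply: nb.
Qed.

(** The windows converge to the indicators of open boxes; intersecting orthants with
a large open box again gives open boxes, so the Dynkin argument applies. *)
Lemma ae_eq0_window3 (R : realType) (g : R * R * R -> R) : locint g ->
  (forall a b n, \int[vol R]_y (g y * window3 a b n y) = 0) ->
  {ae vol R, forall y, g y = 0}.
Proof.
move=> lg g0.
have ibox a b : \int[vol R]_y (g y * \1_(open_box a b) y) = 0.
  apply: (@pair_cvg_eq0 R g lg _ (window3 a b) 1 (radius3 a b)) => //.
  - by move=> n; have [] := test_function_locbd ord0 (test_function_window3 a b n).
  - by apply: measurable_indic; exact: measurable_open_box.
  - by move=> n y _; have /andP[w0 w1] := window3_01 a b n y; rewrite ger0_norm.
  - by move=> n y; exact: window3_out.
  - by apply: aeW => y; exact: window3_cvg.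
have [mg _] := lg.
pose K (n : nat) : set (space R) := open_box (- n%:R, - n%:R, - n%:R) (n%:R, n%:R, n%:R).
have aen (n : nat) : {ae vol R, forall y, g y * \1_(K n) y = 0}.
  apply: (@ae_eq0_dynkin R g (\1_(K n)) g id) => //.
  - by apply: locbd_indic; exact: measurable_open_box.
  - exists (radius3 (- n%:R, - n%:R, - n%:R) (n%:R, n%:R, n%:R)) => y yb.
    by rewrite indicE memNset // => /open_box_sub.
  - exact: aeW.
  - move=> a b c; rewrite -[RHS](ibox (- n%:R, - n%:R, - n%:R)
      (Num.min n%:R a, Num.min n%:R b, Num.min n%:R c)).
    apply: eq_Rintegral => y _; congr (_ * _).
    rewrite !indicE -natrM mulnb; congr (nat_of_bool _)%:R.
    rewrite -in_setI; apply/idP/idP; rewrite !inE /K /open_box /orthant /= !in_itv /= !lt_min.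
      by move=> [[[/andP[-> ->] /andP[-> ->]] /andP[-> ->]] [-> -> ->]].
    by move=> [[/and3P[-> -> ->] /and3P[-> -> ->]] /and3P[-> -> ->]].
have := ae_foralln aen; apply: filterS => y Hy.
have [n [n0 n1]] := ex_nat_gt2 `|y.1.1| `|y.1.2|.
have [m [m0 m1]] := ex_nat_gt2 n%:R `|y.2|.
have := Hy m; rewrite indicE mem_set ?mulr1 //.
rewrite /K /open_box /= !in_itv /= -!ltr_norml m1.
by rewrite (lt_trans n0 m0) (lt_trans n1 m0).
Qed.

Lemma ae_eq_window3 (R : realType) (f g : R * R * R -> R) :
  locint f -> locint g ->
  (forall a b n, \int[vol R]_y (f y * window3 a b n y) =
                 \int[vol R]_y (g y * window3 a b n y)) ->
  {ae vol R, forall y, f y = g y}.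
Proof.
move=> lf lg fg.
have : {ae vol R, forall y, f y - g y = 0}.
  apply: ae_eq0_window3; first exact: locintB.
  move=> a b n.
  have [lw sw _ _] := test_function_locbd ord0 (test_function_window3 a b n).
  by rewrite pairBl // fg subrr.
by apply: filterS => y /subr0_eq.
Qed.

(** * Reflection in the plane *)

Lemma measurable_reflection (R : realType) :
  measurable_fun [set: space R] (@reflection R : space R -> space R).
Proof.
apply: measurable_fun_pair; first exact: measurable_fst.
by apply: measurableT_comp => //; exact: measurable_snd.
Qed.

Lemma reflectionK (R : realType) (y : R * R * R) : reflection (reflection y) = y.
Proof. by rewrite /reflection /= opprK; case: y. Qed.

(** Each vertical section is reflected on the line. *)
Lemma vol_reflection (R : realType) (A : set (space R)) : measurable A ->
  pushforward (vol R) (@reflection R : space R -> space R) A = vol R A.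
Proof.
move=> mA; rewrite /pushforward.
have volE (B : set (space R)) : vol R B =
  (\int[@lebesgue_measure R \x @lebesgue_measure R]_p
     @lebesgue_measure R (xsection B p))%E by [].
rewrite !volE; apply: eq_integral => p _.
have mx := measurable_xsection p mA.
by have H := lebesgue_measureN mx; rewrite -H /pushforward; congr (lebesgue_measure _).
Qed.

Lemma Rintegral_reflection (R : realType) (F : R * R * R -> R) :
  (vol R).-integrable setT (EFin \o F) ->
  \int[vol R]_y F (reflection y) = \int[vol R]_y F y.
Proof.
move=> iF; have ms := @measurable_reflection R.
have mF : measurable_fun [set: space R] (EFin \o F) by exact: measurable_int iF.
have FK : (fun y => (F (reflection y))%:E) \o (@reflection R : space R -> space R) =
    EFin \o F by apply/funext => y /=; rewrite reflectionK.
have H := @integral_pushforward _ _ (space R) (space R) R _ ms (vol R) setT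
  (fun y => (F (reflection y))%:E) (measurableT_comp mF ms).
have e1 : (\int[vol R]_y (F (reflection y))%:E =
    \int[pushforward (vol R) (@reflection R : space R -> space R)]_y
      (F (reflection y))%:E)%E.
  by apply: eq_measure_integral => A mA _; exact/esym/vol_reflection.
congr fine; apply: etrans e1 _; apply: etrans (H _ measurableT) _.
  by rewrite FK.
by rewrite FK.
Qed.

Lemma locint_reflection (R : realType) (f : R * R * R -> R) :
  locint f -> locint (f \o @reflection R).
Proof.
move=> [mf lf]; have ms := @measurable_reflection R.
have mfs : measurable_fun [set: space R] (f \o @reflection R) by exact: measurableT_comp mf ms.
split => // M; apply/integrableP; split.
  by apply/measurable_EFinP; exact: measurable_funS mfs.
have /integrableP[_] := lf M; apply: le_lt_trans; apply: le_of_eq.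
have mb := @measurable_box R M.
pose g : space R -> \bar R := (fun y => `|(f y)%:E|)%E.
have mg : measurable_fun setT g by apply: measurableT_comp => //; exact/measurable_EFinP.
have bE : (@reflection R : space R -> space R) @^-1` box M = box M.
  by apply/seteqP; split => y; rewrite /box /reflection /= normrN.
have H := @ge0_integral_pushforward _ _ (space R) (space R) R _ ms (vol R) (box M) g mb.
rewrite bE in H.
transitivity (\int[pushforward (vol R) (@reflection R : space R -> space R)]_(y in box M) g y)%E.
  apply: esym; apply: H; first exact: measurable_funTS.
  by move=> y _; exact: abse_ge0.
by apply: eq_measure_integral => A mA _; exact: vol_reflection.
Qed.

Lemma pair_reflection (R : realType) (h w : R * R * R -> R) :
  locint h -> locbd w -> bsupp w ->
  \int[vol R]_y (h (reflection y) * w y) = \int[vol R]_y (h y * w (reflection y)).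
Proof.
move=> lh lw sw.
have i := pair_integrable (locint_reflection lh) lw sw.
rewrite -(Rintegral_reflection i); apply: eq_Rintegral => y _ /=.
by rewrite reflectionK.
Qed.

Lemma box_reflection (R : realType) (M : R) (y : R * R * R) :
  box M (reflection y) <-> box M y.
Proof. by rewrite /box /reflection /= normrN. Qed.

Lemma locbd_reflection (R : realType) (w : R * R * R -> R) :
  locbd w -> locbd (w \o @reflection R).
Proof.
move=> [mw bw]; split; first exact: measurableT_comp mw (@measurable_reflection R).
by move=> M; have [C hC] := bw M; exists C => y /box_reflection /hC.
Qed.

Lemma bsupp_reflection (R : realType) (w : R * R * R -> R) :
  bsupp w -> bsupp (w \o @reflection R).
Proof.
by move=> [M hM]; exists M => y yM; apply: hM => /box_reflection.
Qed.

(** The sign picked up by the i-th component of a field, and by the i-th partial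
derivative of a function, under reflection. *)
Definition parity (R : realType) (i : 'I_3) : R := if val i == 2%N then -1 else 1.

Lemma parity_sqr (R : realType) (i : 'I_3) : parity R i * parity R i = 1.
Proof. by rewrite /parity; case: ifP => _; rewrite ?mulrNN mulr1. Qed.

Lemma comp3_reflection (R : realType) (i : 'I_3) (x : R * R * R) :
  comp3 i (reflection x) = parity R i * comp3 i x.
Proof.
by case: i => [[|[|[|//]]] Hi]; rewrite /comp3 /parity /reflection /= ?mul1r ?mulN1r.
Qed.

Lemma window_opp (R : realType) (a b : R) n x :
  window a b n (- x) = window (- b) (- a) n x.
Proof. by rewrite /window mulrC; congr (flat _ _ * flat _ _); ring. Qed.

(** The reflection of the box with corners a and b has the corners
[reflected_corner a b] and [reflected_corner b a]. *)
Definition reflected_corner (R : realType) (a b : R * R * R) : R * R * R := (a.1, - b.2).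

Lemma window3_reflection (R : realType) (a b : R * R * R) n y :
  window3 a b n (reflection y) = window3 (reflected_corner a b) (reflected_corner b a) n y.
Proof. by rewrite /window3 /tensor /reflected_corner /= window_opp. Qed.

Lemma derive_window3_reflection (R : realType) (i : 'I_3) (a b : R * R * R) n y :
  'D_(basis3 R i) (window3 (reflected_corner a b) (reflected_corner b a) n) y =
  parity R i * 'D_(basis3 R i) (window3 a b n) (reflection y).
Proof.
pose f := window a.1.1 b.1.1 n; pose g := window a.1.2 b.1.2 n.
pose k := window a.2 b.2 n.
have [_ [f' [df _]]] : smooth1 1 f by exact: smooth1_window.
have [_ [g' [dg _]]] : smooth1 1 g by exact: smooth1_window.
have [_ [k' [dk _]]] : smooth1 1 k by exact: smooth1_window.
pose kN x := k (- x).
have -> : window3 (reflected_corner a b) (reflected_corner b a) n = tensor f g kN.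
  by apply/funext => z; rewrite -window3_reflection.
have dkN x : is_derive x (1 : R) kN (- k' (- x)).
  have dN : is_derive x (1 : R) (fun z : R => - z) (- 1) by exact: is_deriveNid.
  apply: is_derive_eq (@is_derive1_comp _ k (fun z => - z) x _ _ (dk (- x)) dN) _.
  by rewrite mulrN1.
have [_ ->] := is_derive_tensor y df dg dkN i.
have [_ ->] := is_derive_tensor (reflection y) df dg dk i.
by case: i => [[|[|[|//]]] Hi]; rewrite /parity /tensor /kN /= ?mul1r //; ring.
Qed.

(** Move the reflection from w to f by invariance of the measure; it comes back as a
second factor s. *)
Lemma pair_parity (R : realType) (f w : R * R * R -> R) (s : R) :
  locint f -> locbd w -> bsupp w -> s * s = 1 ->
  {ae vol R, forall y, f (reflection y) = s * f y} ->
  \int[vol R]_y (f y * (s * w (reflection y))) = \int[vol R]_y (f y * w y).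
Proof.
move=> lf lw sw ss fs.
have lp : locint (fun y => f y * s).
  by have [mc bc] := locbd_cst s; exact: locintM.
rewrite pairZ //; last 2 first.
- exact: (locbd_reflection lw).
- exact: (bsupp_reflection sw).
rewrite -pair_reflection // -pairZ //; last exact: locint_reflection.
rewrite (pair_ae_eq (k := fun y => f y * s) (locint_reflection lf)) //.
- apply: eq_Rintegral => y _.
  by rewrite -mulrA [X in f y * X]mulrA ss mul1r.
- by apply: locbdM => //; exact: locbd_cst.
- exact: bsuppMl.
- by apply: filterS fs => y; rewrite mulrC.
Qed.

(** The signs produced by reflecting f and by reflecting the partial derivative of
the test function are the same, so they cancel. *)
Lemma weak_partial_reflection (R : realType) (i : 'I_3) (f g : R * R * R -> R) :
  locint f -> is_weak_partial i f g ->
  {ae vol R, forall y, f (reflection y) = parity R i * f y} ->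
  {ae vol R, forall y, g (reflection y) = g y}.
Proof.
move=> lf [L2g wp] fs; have lg := locint_L2 L2g.
have wpE phi : test_function phi ->
    \int[vol R]_x (f x * 'D_(basis3 R i) phi x) = - \int[vol R]_x (g x * phi x).
  exact: wp.
have E : {ae vol R, forall y, (g \o @reflection R) y = g y}; last exact: E.
apply: ae_eq_window3 => //; first exact: locint_reflection.
move=> a b n.
have t1 := test_function_window3 a b n.
have t2 := test_function_window3 (reflected_corner a b) (reflected_corner b a) n.
have [l1 s1 lD1 sD1] := test_function_locbd i t1.
have [l2 s2 lD2 sD2] := test_function_locbd i t2.
rewrite [LHS](pair_reflection lg l1 s1).
under eq_Rintegral do rewrite window3_reflection.
apply: oppr_inj; apply: etrans (esym (wpE _ t2)) _; apply: etrans _ (wpE _ t1).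
under eq_Rintegral do rewrite derive_window3_reflection.
exact: (pair_parity lf lD1 sD1 (parity_sqr R i) fs).
Qed.

(** * The divergence *)

Lemma weak_partialP (R : realType) (u : R * R * R -> R * R * R) (i : 'I_3) :
  sobolev_H1 u ->
  is_weak_partial i (comp3 i \o u) (weak_partial i (comp3 i \o u)).
Proof. by move=> /(_ i)[_ /(_ i)] /(@xgetPex _ (fun=> 0)). Qed.

Lemma locint_sum (R : realType) n (F : 'I_n -> R * R * R -> R) :
  (forall i, locint (F i)) -> locint (fun y => \sum_(i < n) F i y).
Proof.
elim: n F => [|n IH] F lF.
  under eq_fun do rewrite big_ord0.
  split; first exact: measurable_cst.
  by move=> M; apply: integrable0.
under eq_fun do rewrite big_ord_recl.
by apply: locintD => //; apply: IH.
Qed.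

Lemma locint_divergence (R : realType) (u : R * R * R -> R * R * R) :
  sobolev_H1 u -> locint (divergence u).
Proof.
move=> Hu; apply: locint_sum => i.
by have [/locint_L2] := weak_partialP i Hu.
Qed.

Lemma ae_forall_ord3 (R : realType) (P : 'I_3 -> R * R * R -> Prop) :
  (forall i, {ae vol R, forall y, P i y}) -> {ae vol R, forall y, forall i, P i y}.
Proof.
move=> HP; apply: filterS3 (HP ord0) (HP (lift ord0 ord0)) (HP (lift ord0 (lift ord0 ord0))).
by move=> y h0 h1 h2 [[|[|[|//]]] Hi]; [move: h0|move: h1|move: h2]; congr (P _ y); exact: val_inj.
Qed.

Lemma divergence_reflection (R : realType) (u : R * R * R -> R * R * R) :
  sobolev_H1e u ->
  {ae vol R, forall y, divergence u (reflection y) = divergence u y}.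
Proof.
move=> [Hu eu].
have ev i : {ae vol R, forall y, weak_partial i (comp3 i \o u) (reflection y) =
    weak_partial i (comp3 i \o u) y}.
  apply: weak_partial_reflection (weak_partialP i Hu) _.
    by have [/locint_L2] := Hu i.
  have {}eu : {ae vol R, forall y, u (reflection y) = reflection (u y)} by exact: eu.
  by apply: filterS eu => y /= ->; exact: comp3_reflection.
by apply: filterS (ae_forall_ord3 ev) => y h; apply: eq_bigr => i _.
Qed.

Lemma in_L2B (R : realType) (f g : R * R * R -> R) :
  in_L2 f -> in_L2 g -> in_L2 (f \- g).
Proof.
have p1 : (1 <= 2%:E :> \bar R)%E by rewrite lee_fin ler1n.
have [_ hadd] := @Lfun_addr_closed _ _ R (vol R) _ p1.
have hopp := @Lfun_oppr_closed _ _ R (vol R) 2%:E.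
by move=> hf hg; apply: hadd => //; exact: hopp.
Qed.

Lemma is_weak_partialB (R : realType) (i : 'I_3) (f1 f2 g1 g2 : R * R * R -> R) :
  in_L2 f1 -> in_L2 f2 -> is_weak_partial i f1 g1 -> is_weak_partial i f2 g2 ->
  is_weak_partial i (f1 \- f2) (g1 \- g2).
Proof.
move=> L1 L2 [Lg1 w1] [Lg2 w2]; split; first exact: in_L2B.
move=> phi tphi; have [l s lD sD] := test_function_locbd i tphi.
have e1 := pairBl (locint_L2 L1) (locint_L2 L2) lD sD.
have e2 := pairBl (locint_L2 Lg1) (locint_L2 Lg2) l s.
apply: etrans e1 _.
apply: etrans (congr2 (fun a b => a - b) (w1 _ tphi) (w2 _ tphi)) _.
apply: esym; apply: etrans (congr1 -%R e2) _.
by rewrite opprB opprK addrC.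
Qed.

Lemma is_weak_partial_unique (R : realType) (i : 'I_3) (f g k : R * R * R -> R) :
  is_weak_partial i f g -> is_weak_partial i f k ->
  {ae vol R, forall y, g y = k y}.
Proof.
move=> [Lg wg] [Lk wk].
apply: ae_eq_window3 => [||a b n]; [exact: locint_L2|exact: locint_L2|].
have tphi := test_function_window3 a b n.
by apply: oppr_inj; apply: etrans (esym (wg _ tphi)) (wk _ tphi).
Qed.

(** The difference of weak derivatives is a weak derivative of the difference;
uniqueness identifies it with the chosen one. *)
Lemma divergenceB (R : realType) (u1 u2 : R * R * R -> R * R * R) :
  sobolev_H1 u1 -> sobolev_H1 u2 ->
  {ae vol R, forall y,
    divergence (u1 \- u2) y = divergence u1 y - divergence u2 y}.
Proof.
move=> H1 H2.
have ev i : {ae vol R, forall y, weak_partial i (comp3 i \o (u1 \- u2)) y =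
    weak_partial i (comp3 i \o u1) y - weak_partial i (comp3 i \o u2) y}.
  have E : comp3 i \o (u1 \- u2) = (comp3 i \o u1) \- (comp3 i \o u2).
    by apply/funext => y; case: i => [[|[|[|//]]] Hi].
  have [L1 _] := H1 i; have [L2 _] := H2 i.
  have w := is_weak_partialB L1 L2 (weak_partialP i H1) (weak_partialP i H2).
  rewrite -E in w.
  apply: is_weak_partial_unique (w).
  by apply: (@xgetPex _ (fun=> 0)); eexists; exact: w.
apply: filterS (ae_forall_ord3 ev) => y h; rewrite /divergence -sumrB.
by apply: eq_bigr => i _; exact: h.
Qed.

Lemma pair_ae_eq0 (R : realType) (h w : R * R * R -> R) :
  locint h -> locbd w -> bsupp w ->
  {ae vol R, forall y, h y * w y = 0} -> \int[vol R]_y (h y * w y) = 0.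
Proof.
move=> lh lw sw hw0; have i := measurable_int _ (pair_integrable lh lw sw).
have e : (\int[vol R]_y (h y * w y)%:E = \int[vol R]_y (cst 0 y))%E.
  apply: ae_eq_integral; [exact: measurableT|exact: i|exact: measurable_cst|].
  by apply: filterS hw0 => y hy _ /=; rewrite hy.
by rewrite /Rintegral e integral0.
Qed.

(** * The transform *)

Lemma ball_integrals_eq0_iff (R : realType) (Gamma : set (R * R)) (Rmax : R)
    (f : R * R * R -> R) :
  open Gamma -> 0 < Rmax -> locint f ->
  {ae vol R, forall y, f (reflection y) = f y} ->
  {ae vol R, forall p, (Gamma `*` `]0, Rmax[) p ->
     \int[vol R]_y (f y * \1_(vball p.1 (p.2 ^+ 2)) y) = 0} <->
  {ae vol R, forall y, Omega Gamma Rmax y -> f y = 0}.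
Proof.
move=> oG R0 lf ef; split => [Mf|f0].
  apply: (ball_null_ae_eq0_Omega R0 oG _ ef); apply: ball_null_of_ae => //.
  apply: filterS Mf => p + Gp p0 pR; apply.
  by split => //=; rewrite in_itv /= p0.
apply: aeW => -[x r] [/= Gx]; rewrite in_itv /= => /andP[r0 rR].
apply: pair_ae_eq0 => //; [exact: locbd_vball|exact: bsupp_vball|].
apply: filterS f0 => y h.
have [yB|yB] := pselect (vball x (r ^+ 2) y); last first.
  by rewrite indicE memNset // mulr0.
rewrite h ?mul0r //; exists x => //; apply/eball_rho => //.
by apply: lt_le_trans yB _; rewrite ler_pXn2r ?nnegrE // ltW.
Qed.

Lemma forwardM_eqP (R : realType) (u1 u2 : R * R * R -> R * R * R)
    (p : R * R * R) : sobolev_H1 u1 -> sobolev_H1 u2 -> 0 < p.2 ->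
  forwardM u1 p = forwardM u2 p <->
  \int[vol R]_y ((divergence u1 y - divergence u2 y) *
    \1_(vball p.1 (p.2 ^+ 2)) y) = 0.
Proof.
move=> /locint_divergence l1 /locint_divergence l2 p0.
rewrite /forwardM (Rintegral_eball (divergence u1) p.1 p0).
rewrite (Rintegral_eball (divergence u2) p.1 p0).
move: (divergence u1) (divergence u2) l1 l2 => d1 d2 l1 l2.
rewrite pairBl //; [|exact: locbd_vball|exact: bsupp_vball].
split => [/mulfI ->|/eqP]; last by rewrite subr_eq0 => /eqP ->.
  by rewrite subrr.
by rewrite oppr_eq0 invr_eq0 expf_neq0 // gt_eqF.
Qed.

Theorem theorem4p1 (R : realType) (Gamma : set (R * R)) (Rmax : R)
    (u1 u2 : R * R * R -> R * R * R)
    (openGamma : open Gamma) (Rmax_gt0 : 0 < Rmax)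
    (H1e_u1 : sobolev_H1e u1) (H1e_u2 : sobolev_H1e u2) :
  ae_eq (leb3 R) (Gamma `*` `]0, Rmax[) (forwardM u1) (forwardM u2) <->
  ae_eq (leb3 R) (Omega Gamma Rmax) (divergence (u1 \- u2)) (cst 0).
Proof.
have [H1 _] := H1e_u1; have [H2 _] := H1e_u2.
pose f y := divergence u1 y - divergence u2 y.
have lf : locint f by apply: locintB; exact: locint_divergence.
have f_even : {ae vol R, forall y, f (reflection y) = f y}.
  apply: filterS2 (divergence_reflection H1e_u1) (divergence_reflection H1e_u2).
  by move=> y e1 e2; rewrite /f e1 e2.
have core := ball_integrals_eq0_iff openGamma Rmax_gt0 lf f_even.
suff main : {ae vol R, forall p, (Gamma `*` `]0, Rmax[) p ->
      forwardM u1 p = forwardM u2 p} <->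
    {ae vol R, forall y, Omega Gamma Rmax y -> divergence (u1 \- u2) y = 0}.
  exact: main.
split => [Meq|div0].
  have /core f0 : {ae vol R, forall p, (Gamma `*` `]0, Rmax[) p ->
      \int[vol R]_y (f y * \1_(vball p.1 (p.2 ^+ 2)) y) = 0}.
    apply: filterS Meq => p Mp Gp.
    apply: (proj1 (forwardM_eqP H1 H2 _) (Mp Gp)).
    by case: Gp => _; rewrite /= in_itv => /andP[].
  apply: filterS2 (divergenceB H1 H2) f0 => y e h Oy.
  exact: etrans e (h Oy).
have /core : {ae vol R, forall y, Omega Gamma Rmax y -> f y = 0}.
  apply: filterS2 (divergenceB H1 H2) div0 => y e h Oy.
  exact: etrans (esym e) (h Oy).
apply: filterS => p Mp Gp.
apply: (proj2 (forwardM_eqP H1 H2 _) (Mp Gp)).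
by case: Gp => _; rewrite /= in_itv => /andP[].
Qed.
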